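(* Let $r\ge2$, $\boldsymbol d^\vee=(1,\ldots,1,2)\in\mathbb{Z}^r$, and let $B^\vee$, $\boldsymbol b_i$, $c_i$ ($0\le i\le r$) and $h_j^\vee$ ($1\le j\le2r-2$) be as defined in the context. For $0\le i\le r$ and $\sigma\in\{0,1\}$ write $F_{i,\sigma}(\tau)=\widetilde f_{B^\vee,2\boldsymbol b_i,2c_i,2\boldsymbol d^\vee,\sigma}(\tau)$ (partial Nahm sums, see context). Then $$h_{2r-2}^\vee(2\tau)=\frac12\Big(F_{0,0}(\tau)-F_{0,1}(\tau)+F_{0,0}\big(\tau+\tfrac12\big)-F_{0,1}\big(\tau+\tfrac12\big)\Big),$$ and for every odd $j$ with $1\le j\le2r-3$, putting $i=r-\frac{j+1}2$, $$h_j^\vee(2\tau)=\frac12\Big(F_{i,0}(\tau)-F_{i,1}(\tau)+F_{i,0}\big(\tau+\tfrac12\big)-F_{i,1}\big(\tau+\tfrac12\big)\Big).$$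
   Context: Notation: $\mathrm{Im}\,\tau>0$, $q=e^{2\pi\sqrt{-1}\tau}$, $q^x=e^{2\pi\sqrt{-1}x\tau}$ for rational $x$; $(a;p)_\infty=\prod_{n\ge0}(1-ap^n)$, $(a;p)_n=\prod_{k=0}^{n-1}(1-ap^k)$, $(a_1,\ldots,a_k;p)_\infty=\prod_i(a_i;p)_\infty$; $\mathbb{N}=\{0,1,2,\ldots\}$. Partial Nahm sums: for $\boldsymbol d=(d_1,\ldots,d_r)\in\mathbb{Z}_{>0}^r$, $D=\mathrm{diag}(d_1,\ldots,d_r)$, $A\in\mathbb{Q}^{r\times r}$ with $AD$ symmetric positive definite, $\boldsymbol b\in\mathbb{Q}^r$, $c\in\mathbb{Q}$, $\sigma\in\{0,1\}$, $$\widetilde f_{A,\boldsymbol b,c,\boldsymbol d,\sigma}(\tau)=\sum_{\boldsymbol n=(n_1,\ldots,n_r)^T\in\mathbb{N}^r,\ n_r\equiv\sigma\ (\mathrm{mod}\ 2)}\frac{q^{\frac12\boldsymbol n^TAD\boldsymbol n+\boldsymbol n^T\boldsymbol b+c}}{(q^{d_1};q^{d_1})_{n_1}\cdots(q^{d_r};q^{d_r})_{n_r}}.$$ $B^\vee=(B^\vee_{ij})$ is the $r\times r$ matrix with $B^\vee_{11}=1$, $B^\vee_{1r}=\frac12$, $B^\vee_{r1}=1$, $B^\vee_{1j}=B^\vee_{j1}=0$ for $2\le j\le r-1$, $B^\vee_{ij}=2(\min(i,j)-1)$ for $2\le i\le r$, $2\le j\le r-1$, $B^\vee_{ir}=i-1$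 for $2\le i\le r-1$, $B^\vee_{rr}=r-\frac12$. $\boldsymbol b_0=(1,1,2,3,\ldots,r-1)^T$ (first entry $1$, $k$-th entry $k-1$ for $2\le k\le r$), $c_0=\frac{4r^2-11r+7}{16r-12}$; for $1\le i\le r$, $\boldsymbol b_i=(0,\ldots,0,1,2,\ldots,r-i-1,r-i-1)^T$ ($k$-th entry $\max(k-i,0)$ for $1\le k\le r-1$, last entry $r-i-1$), $c_i=\frac{4(r-i)^2+6i-7r+3}{16r-12}$. For $1\le j\le2r-2$, $h_j^\vee$ is defined by $$h_j^\vee(2\tau)=\frac12q^{\frac{j^2-j-r+1}{8r-6}}\left(\frac{(q^{2r-j-1},q^{2r+j-2},q^{4r-3};q^{4r-3})_\infty}{(q,q^3,q^4;q^4)_\infty}+\frac{((-q)^{2r-j-1},(-q)^{2r+j-2},-q^{4r-3};-q^{4r-3})_\infty}{(-q,-q^3,q^4;q^4)_\infty}\right).$$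
   Formalization: Read literally, F(τ+1/2) carries an extra root of unity e^{2πi c_i} from q^{2c_i}, so the identities fail (e.g. r=2, i=0, c_0=1/20); the formal theorem multiplies the two τ+1/2 terms by e^{-2πi c_i}, i.e. only q→−q is applied to the series. *)

(* Defs.v *)
From HB Require Import structures.
From mathcomp Require Export all_boot all_order all_algebra complex.
From mathcomp Require Export mathcomp_extra boolp classical_sets functions reals.
From mathcomp Require Export topology normedtype sequences exp trigo summability.

Set Implicit Arguments.
Unset Strict Implicit.
Unset Printing Implicit Defensive.

Export Order.TTheory GRing.Theory Num.Theory numFieldNormedType.Exports.

Local Open Scope classical_set_scope.
Local Open Scope ring_scope.
Local Open Scope complex_scope.

Definition cexp (R : realType) (z : R[i]) : R[i] :=
  let: a +i* b := z in (expR a)%:C * (cos b +i* sin b).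

(* e^(2 pi sqrt(-1) z) *)
Definition e2pi (R : realType) (z : R[i]) : R[i] := cexp ((2 * pi) *i * z).

(* q^x = e^(2 pi sqrt(-1) x tau): since x need not be an integer, this is a
   function of tau and not of the number q = e^(2 pi sqrt(-1) tau). *)
Definition qpow (R : realType) (x : rat) (tau : R[i]) : R[i] :=
  e2pi (ratr x * tau).

(* (a; p)_n *)
Definition qpoch (R : realType) (a p : R[i]) (n : nat) : R[i] :=
  \prod_(k < n) (1 - a * p ^+ k).

(* (a; p)_oo. The regular algebra R[i]^o carries the usual topology of the
   complex plane. *)
Definition qpoch_inf (R : realType) (a p : R[i]) : R[i] :=
  limn (qpoch a p : nat -> R[i]^o).

(* (a_1, ..., a_k; p)_oo *)
Definition qpochs_inf (R : realType) (s : seq R[i]) (p : R[i]) : R[i] :=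
  \prod_(a <- s) qpoch_inf a p.

Definition nahm_term (R : realType) (r : nat) (A : 'M[rat]_r) (b : 'cV[rat]_r)
    (c : rat) (d : 'I_r -> nat) (tau : R[i]) (n : {ffun 'I_r -> nat}) : R[i] :=
  let D : 'M[rat]_r := diag_mx (\row_k (d k)%:R) in
  let v : 'cV[rat]_r := \col_k (n k)%:R in
  qpow (2^-1 * (v^T *m A *m D *m v) 0 0 + (v^T *m b) 0 0 + c) tau
  / \prod_(k < r) qpoch (qpow (d k)%:R tau) (qpow (d k)%:R tau) (n k).

(* The sum over n in N^r with n_r = sigma mod 2, where N^r is indexed by
   0, ..., r-1, so that the last coordinate is the one with k.+1 = r. [sum] is
   the unordered sum, i.e. the limit along the directed set of finite subsets
   of N^r; it is meaningful when 0 < Im tau, the d_k are positive and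
   A diag(d) is symmetric positive definite. *)
Definition partial_nahm (R : realType) (r : nat) (A : 'M[rat]_r)
    (b : 'cV[rat]_r) (c : rat) (d : 'I_r -> nat) (sigma : nat) (tau : R[i]) :
    R[i] :=
  sum (fun n : {ffun 'I_r -> nat} =>
    (if [forall k : 'I_r, (k.+1 == r) ==> (n k == sigma %[mod 2])]
     then nahm_term A b c d tau n else 0) : R[i]^o).

Definition d_vee (r : nat) (k : 'I_r) : nat := if k.+1 == r then 2 else 1.

(* The entries are written with the indices i, j ranging over 1, ..., r. *)
Definition B_vee_entry (r i j : nat) : rat :=
  if i == 1%N then
    if j == 1%N then 1 else if j == r then 2^-1 else 0
  else if j == 1%N then
    if i == r then 1 else 0
  else if (j < r)%N then 2 * ((minn i j)%:R - 1)
  else if (i < r)%N then i%:R - 1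
  else r%:R - 2^-1.

Definition B_vee (r : nat) : 'M[rat]_r :=
  \matrix_(i, j) B_vee_entry r i.+1 j.+1.

(* b_i for 0 <= i <= r, with k ranging over 1, ..., r; the last entry of b_r
   is -1. *)
Definition b_vec_entry (r i k : nat) : rat :=
  if i == 0%N then
    if k == 1%N then 1 else k%:R - 1
  else if (k < r)%N then Num.max (k%:R - i%:R) 0
  else r%:R - i%:R - 1.

Definition b_vec (r i : nat) : 'cV[rat]_r := \col_k b_vec_entry r i k.+1.

Definition c_const (r i : nat) : rat :=
  if i == 0%N then (4 * r%:R ^+ 2 - 11 * r%:R + 7) / (16 * r%:R - 12)
  else (4 * (r%:R - i%:R) ^+ 2 + 6 * i%:R - 7 * r%:R + 3) / (16 * r%:R - 12).

(* The translation tau -> tau + 1/2 acts on F_{i,sigma} in two ways: by q -> -q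
   on a power series in q, and by the root of unity e^(2 pi sqrt(-1) c_i) on
   the leading factor q^(2 c_i). *)
Definition F_sum (R : realType) (r i sigma : nat) (tau : R[i]) : R[i] :=
  partial_nahm (B_vee r) (2 *: b_vec r i) (2 * c_const r i)
    (fun k : 'I_r => (2 * d_vee k)%N) sigma tau.

(* h_j^vee, for 1 <= j <= 2r-2, is prescribed by its values at 2 tau; here
   tau = z / 2. The factor q^((j^2-j-r+1)/(8r-6)) is common to both summands:
   only the product is subjected to q -> -q. *)
Definition h_vee (R : realType) (r j : nat) (z : R[i]) : R[i] :=
  let tau := z / 2 in
  let q := qpow 1 tau in
  2^-1 * qpow ((j%:R ^+ 2 - j%:R - r%:R + 1) / (8 * r%:R - 6)) tau *
  (qpochs_inf [:: q ^+ (2 * r - j - 1); q ^+ (2 * r + j - 2); q ^+ (4 * r - 3)]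
     (q ^+ (4 * r - 3))
   / qpochs_inf [:: q; q ^+ 3; q ^+ 4] (q ^+ 4)
   + qpochs_inf [:: (- q) ^+ (2 * r - j - 1); (- q) ^+ (2 * r + j - 2);
                    - q ^+ (4 * r - 3)] (- q ^+ (4 * r - 3))
     / qpochs_inf [:: - q; - q ^+ 3; q ^+ 4] (q ^+ 4)).

(* Main.v *)
Require Import Defs.
From mathcomp Require Import finmap.
From mathcomp Require Import zify ring lra.

(* Put p = q^2. Summing over n_1 with Euler's identity, and writing
   N_k = n_k + ... + n_r, turns F_{i,0} - F_{i,1} into (-q; p)_oo times a Bailey
   chain in base p that ends in

     beta_n = (-1)^n q^(n^2) / ((p^2; p^2)_n (-q; p)_n),

   or the same with (-q; p)_(n+1) when i = 0. This beta_n equals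
   sum_k (-1)^k q^(k(k-1)/2) / ((p; p)_(n-k) (p; p)_(n+k)), respectively with
   (p; p)_(n+k+1), i.e. it belongs to a Bailey pair relative to 1, respectively
   to p. Each N_k is eliminated by the Bailey lemma. For 0 < i < r the linear
   terms occur only for i < k < r, so one passes from pairs relative to 1 to
   pairs relative to p and back; written as bilateral sums, both passages leave
   the coefficients unchanged, by antisymmetry under k -> -1-k. What remains is a
   theta series, which the Jacobi triple product evaluates. The second half of
   each identity is the first one at tau + 1/2, where q becomes -q.

   All summations are carried out as finite identities, with weights inserted
   in the multiple sum; the infinite ones follow by dominated convergence. *)

Set Implicit Arguments.
Unset Strict Implicit.
Unset Printing Implicit Defensive.

Local Open Scope ring_scope.
Local Open Scope complex_scope.

(** * Bilateral sums and the Bailey lemma *)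

(** For the doubled data half the quadratic form is (n_1+n_r)^2 + 2(N_2^2+...+N_r^2), so n_1
    interacts with n_r alone. For fixed n_r Euler's identity gives (-q^(2n_r+2d+1); p)_oo = (-q;
    p)_oo / (-q; p)_(n_r+d), where d = 1 if i = 0 and d = 0 otherwise; hence the factor (-q;
    p)_(n+d) in beta_n. The sign (-1)^n separates the two parities of n_r, and (p^2; p^2)_n comes
    from the last entry 2 of d^vee. Rearranging the infinite multiple series would call for absolute
    convergence at every intermediate stage. With the weights all rearrangements take place in
    finite sums, and two kinds of limit remain: that of the weighted Nahm sums and that of the final
    bilateral sum. Both have geometric majorants, because the exponents grow at least linearly in
    the indices. *)

Section BilateralSums.
Variable V : nmodType.
Implicit Types (F G : int -> V) (N : nat).

Definition bsum N F : V := \sum_(i < N.*2.+1) F (i%:Z - N%:Z).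

Lemma eq_bsum N F G : F =1 G -> bsum N F = bsum N G.
Proof. by move=> FG; apply: eq_bigr => i _; rewrite FG. Qed.

Lemma bsum_opp N F : bsum N (fun k => F (- k)) = bsum N F.
Proof.
rewrite /bsum (reindex_inj rev_ord_inj) /=; apply: eq_bigr => i _.
by congr F; have := ltn_ord i; lia.
Qed.

(** The shifted window loses F(-N) and gains F(N+1). In the applications the kernel vanishes at both
    places. *)
Lemma bsum_succ N F : F (- N%:Z) = 0 -> F (N%:Z + 1) = 0 ->
  bsum N (fun k => F (k + 1)) = bsum N F.
Proof.
move=> F0 F1; rewrite /bsum.
transitivity (\sum_(i < N.*2.+2) F (i%:Z - N%:Z)).
  rewrite [RHS]big_ord_recl /= sub0r F0 add0r; apply: eq_bigr => i _.
  by congr F; rewrite /bump /=; lia.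
rewrite [LHS]big_ord_recr /= [X in _ + X](_ : _ = 0) ?addr0 //.
by rewrite -[RHS]F1; congr F; lia.
Qed.

Lemma bsum_refl1 N F : F N%:Z = 0 -> F (- N%:Z - 1) = 0 ->
  bsum N (fun k => F (- k - 1)) = bsum N F.
Proof.
move=> F0 F1; rewrite -[RHS]bsum_opp -(@bsum_succ N (fun k => F (- k))) ?opprK //.
  by apply: eq_bsum => k; congr F; lia.
by rewrite -[RHS]F1; congr F; lia.
Qed.

Lemma bsumD N F G : bsum N (fun k => F k + G k) = bsum N F + bsum N G.
Proof. exact: big_split. Qed.

Lemma bsum_support0 N F : (forall k, k != 0 -> F k = 0) -> bsum N F = F 0.
Proof.
move=> F0; have lN : (N < N.*2.+1)%N by lia.
rewrite /bsum (bigD1 (Ordinal lN)) //= subrr big1 ?addr0 // => i.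
by rewrite -val_eqE /= => iN; apply: F0; lia.
Qed.

End BilateralSums.

Lemma bsumZ (K : pzRingType) N (c : K) F : bsum N (fun k => c * F k) = c * bsum N F.
Proof. by rewrite /bsum mulr_sumr. Qed.

Lemma bsumB (K : zmodType) N (F G : int -> K) :
  bsum N (fun k => F k - G k) = bsum N F - bsum N G.
Proof. exact: sumrB. Qed.

(** The product [qpoch] over an arbitrary ring, since the finite identities are pure algebra. Over
    [R[i]] the two are convertible, so [qpoch_inf] is the limit of [poch]. *)
Definition poch (K : pzRingType) (a p : K) (n : nat) : K :=
  \prod_(k < n) (1 - a * p ^+ k).

Lemma pochS (K : pzRingType) (a p : K) n :
  poch a p n.+1 = poch a p n * (1 - a * p ^+ n).
Proof. by rewrite /poch big_ord_recr. Qed.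

Lemma pochSl (K : pzRingType) (a p : K) n :
  poch a p n.+1 = (1 - a) * poch (a * p) p n.
Proof.
rewrite /poch big_ord_recl /= expr0 mulr1; congr (_ * _).
by apply: eq_bigr => i _; rewrite /bump /= exprS mulrA.
Qed.

Lemma poch0 (K : pzRingType) (a p : K) : poch a p 0 = 1.
Proof. by rewrite /poch big_ord0. Qed.

(** * Reciprocal Pochhammer symbols, Bailey kernels and Bailey's lemma *)

Section InversePochhammer.
Variables (K : fieldType) (p : K).
Hypothesis p_neq1 : forall n, p ^+ n.+1 != 1.

(** The value 0 at negative m makes the recurrence [rp_pred] hold at every integer; kernels then
    have finite support and sums can be shifted freely. *)
Definition rp (m : int) : K := if m is Posz n then (poch p p n)^-1 else 0.
Arguments rp : simpl never.

Lemma poch_neq0 n : poch p p n != 0.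
Proof.
elim: n => [|n IH]; first by rewrite poch0 oner_neq0.
by rewrite pochS mulf_neq0 // -exprS subr_eq0 eq_sym.
Qed.

Lemma rp_lt0 m : m < 0 -> rp m = 0. Proof. by case: m. Qed.

Lemma rp0 : rp 0 = 1. Proof. by rewrite -[0]/(Posz 0) /rp poch0 invr1. Qed.

Lemma rp_pred m : rp (m - 1) = (1 - p ^ m) * rp m.
Proof.
case: m => [[|n]|n].
- by rewrite expr0z subrr mul0r.
- rewrite (_ : n.+1%:Z - 1 = n%:Z); last lia.
  rewrite /rp /= pochS -exprS -exprnP invfM mulrCA divff ?mulr1 //.
  by rewrite subr_eq0 eq_sym.
- by rewrite /rp mulr0.
Qed.

(** Induction on L with a free: split 1 - p^(L+1) as (1 - p^(L+1-s)) + p^(L+1-s) (1 - p^s). The two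
    parts lower L+1-s and s respectively and yield the instances (L, a) and (L, a+1). Terms with s >
    L vanish, so the bound n is slack. *)
Lemma q_vandermonde (L : nat) (a : int) (n : nat) : p != 0 -> (L <= n)%N ->
  \sum_(s < n.+1) p ^ (s%:Z ^+ 2 + a * s%:Z) * (rp (L%:Z - s%:Z) * rp s%:Z * rp (s%:Z + a))
  = rp L%:Z * rp (L%:Z + a).
Proof.
move=> p0; elim: L a n => [|L IH] a n Ln.
  rewrite (bigD1 ord0) //= big1 ?addr0 => [|i]; last first.
    rewrite -val_eqE /= => i0; rewrite (@rp_lt0 (_ - _)) ?mul0r ?mulr0 //; lia.
  by rewrite mulr0 expr0n addr0 expr0z mul1r rp0 mulr1.
apply: (@mulfI _ (1 - p ^ L.+1%:Z)).
  by rewrite subr_eq0 eq_sym -exprnP.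
have e1 : L.+1%:Z - 1 = L%:Z by lia.
rewrite mulrA -rp_pred e1.
transitivity (rp L%:Z * (rp (L%:Z + a) + p ^ (L.+1%:Z + a) * rp (L.+1%:Z + a))); last first.
  by rewrite (_ : L%:Z + a = L.+1%:Z + a - 1) ?rp_pred; [ring | lia].
rewrite mulrDr -(IH a n) ?(ltnW Ln) //.
have -> : rp L%:Z * (p ^ (L.+1%:Z + a) * rp (L.+1%:Z + a)) =
  p ^ (L.+1%:Z + a) * (rp L%:Z * rp (L%:Z + (a + 1))).
  by rewrite mulrCA; congr (_ * (_ * rp _)); lia.
case: n Ln => // n Ln.
rewrite -(IH (a + 1) n) // [in RHS]mulr_sumr mulr_sumr.
transitivity (\sum_(s < n.+2) (p ^ (s%:Z ^+ 2 + a * s%:Z)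
      * (rp (L%:Z - s%:Z) * rp s%:Z * rp (s%:Z + a))
  + p ^ (L.+1%:Z - s%:Z) * (p ^ (s%:Z ^+ 2 + a * s%:Z)
      * (rp (L.+1%:Z - s%:Z) * rp (s%:Z - 1) * rp (s%:Z + a))))).
  apply: eq_bigr => s _; rewrite (_ : L%:Z - s%:Z = L.+1%:Z - s%:Z - 1); last lia.
  rewrite !rp_pred (_ : p ^ L.+1%:Z = p ^ (L.+1%:Z - s%:Z) * p ^ s%:Z); last first.
    by rewrite -expfzDr //; congr (_ ^ _); lia.
  ring.
rewrite big_split /=; congr (_ + _).
rewrite big_ord_recl /= (@rp_lt0 (0%:Z - 1)) // !(mulr0, mul0r) add0r.
apply: eq_bigr => s _; rewrite /bump /= !mulrA -!expfzDr //.
congr (_ ^ _ * _ * _ * _); try (congr rp); rewrite ?add1n; try lia.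
Qed.

(* [beta n = bsum N (fun k => c k * kern a n k)] says that [beta] belongs to a
   Bailey pair relative to p^a, with [c] folded along k -> -k-a. *)
Definition kern (a : nat) (n k : int) : K := rp (n - k) * rp (n + k + a%:Z).

Lemma kern_gt a n k : n < k -> kern a n k = 0.
Proof. by move=> nk; rewrite /kern rp_lt0 ?mul0r //; lia. Qed.

Lemma kern_lt a n k : k < - n - a%:Z -> kern a n k = 0.
Proof. by move=> nk; rewrite /kern (@rp_lt0 (_ + a%:Z)) ?mulr0 //; lia. Qed.

Lemma kern_refl a n k : kern a n (- k - a%:Z) = kern a n k.
Proof. by rewrite /kern mulrC; congr (rp _ * rp _); lia. Qed.

Lemma kern0_opp n k : kern 0 n (- k) = kern 0 n k.
Proof. by rewrite -[RHS]kern_refl subr0. Qed.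

Lemma kern1_refl n k : kern 1 n (- k - 1) = kern 1 n k.
Proof. exact: kern_refl. Qed.

Lemma kern01 n k : kern 0 n k = (1 - p ^ (n + k + 1)) * kern 1 n k.
Proof.
by rewrite mulrCA -rp_pred /kern; congr (_ * rp _); lia.
Qed.

Lemma kern10 n k : kern 1 n k = (1 - p ^ (n + 1 - k)) * kern 0 (n + 1) k.
Proof.
rewrite mulrA -rp_pred /kern; congr (rp _ * rp _); lia.
Qed.

Lemma kern01s n k : kern 0 n (k + 1) = (1 - p ^ (n - k)) * kern 1 n k.
Proof.
by rewrite mulrA -rp_pred /kern; congr (rp _ * rp _); lia.
Qed.

Lemma kern00s n k :
  (1 - p ^ (n + k + 1)) * kern 0 n (k + 1) = (1 - p ^ (n - k)) * kern 0 n k.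
Proof. by rewrite kern01s kern01; ring. Qed.

(** Bailey's lemma with both parameters sent to infinity, for a single kernel. The reflection k ->
    -k-a makes k nonnegative because a <= 1; with m = k + s it becomes [q_vandermonde] for L = n - k
    and shift 2k + a. *)
Lemma kern_bailey a (n N : nat) k : p != 0 -> (a <= 1)%N -> (n <= N)%N ->
  \sum_(m < N.+1) p ^ (m%:Z ^+ 2 + a%:Z * m%:Z) * (rp (n%:Z - m%:Z) * kern a m%:Z k)
  = p ^ (k ^+ 2 + a%:Z * k) * kern a n%:Z k.
Proof.
move=> p0 a1 nN; wlog k0 : k / 0 <= k => [H|].
  have [|k0] := leP 0 k; first exact: H.
  have -> : k ^+ 2 + a%:Z * k = (- k - a%:Z) ^+ 2 + a%:Z * (- k - a%:Z) by ring.
  rewrite -kern_refl -H; last lia.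
  by apply: eq_bigr => i _; rewrite kern_refl.
case: k k0 => // k _.
have [kn|nk] := leqP k n; last first.
  rewrite kern_gt ?mulr0; last lia.
  apply: big1 => m _; case: (leqP m n) => mn; first by rewrite kern_gt ?mulr0 //; lia.
  by rewrite (@rp_lt0 (_ - _)) ?mul0r ?mulr0 //; lia.
have -> : kern a n%:Z k%:Z = rp (n - k)%N%:Z * rp ((n - k)%N%:Z + (k.*2 + a)%N%:Z).
  by rewrite /kern; congr (rp _ * rp _); lia.
rewrite -(@q_vandermonde _ _ (N - k)) // ?leq_sub2r // mulr_sumr.
rewrite -(big_mkord xpredT (fun m => p ^ (m%:Z ^+ 2 + a%:Z * m%:Z) * (rp (n%:Z - m%:Z) * kern a m%:Z k%:Z))).
rewrite (@big_cat_nat _ _ _ k) //=; last lia.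
rewrite big_nat big1 ?add0r => [|m mk]; last by rewrite kern_gt ?mulr0 //; lia.
rewrite -{1}[k]add0n big_addn big_mkord (_ : (N.+1 - k = (N - k).+1)%N); last lia.
apply: eq_bigr => s _; rewrite mulrA -expfzDr //; congr (_ ^ _ * _).
  by rewrite -addnn !PoszD; ring.
by rewrite -mulrA; congr (rp _ * (rp _ * rp _)); lia.
Qed.

Lemma kern10s n k : kern 1 n (k - 1) = (1 - p ^ (n + 1 + k)) * kern 0 (n + 1) k.
Proof.
by rewrite /kern [_ + 0%:Z]addr0 mulrCA -rp_pred; congr (rp _ * rp _); lia.
Qed.

(* Summing against [kern 0] and [kern 1] agrees when [c k * p ^ k] is
   antisymmetric, since [kern 1 n k - kern 0 n k] is [p ^ (n + 1)] times
   [p ^ k * kern 1 n k]. *)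
Lemma bsum_kern01 (n N : nat) (c : int -> K) : p != 0 -> 2%:R != 0 :> K ->
  (n.+1 < N)%N -> (forall k, c (- k - 1) * p ^ (- k - 1) = - (c k * p ^ k)) ->
  bsum N (fun k => c k * kern 0 n%:Z k) = bsum N (fun k => c k * kern 1 n%:Z k).
Proof.
move=> p0 K2 nN cN.
pose S := bsum N (fun k => c k * p ^ k * kern 1 n%:Z k).
have S0 : S = 0.
  have : S = - S.
    rewrite -mulN1r -bsumZ /S -[LHS]bsum_refl1.
    - by apply: eq_bsum => k; rewrite cN kern1_refl mulN1r mulNr.
    - by rewrite kern_gt ?mulr0 //; lia.
    - by rewrite kern_lt ?mulr0 //; lia.
  by move/eqP; rewrite -subr_eq0 opprK -mulr2n -mulr_natl mulf_eq0 (negPf K2) => /eqP.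
transitivity (bsum N (fun k => c k * kern 1 n%:Z k) - p ^ (n%:Z + 1) * S).
  rewrite -bsumZ -bsumB; apply: eq_bsum => k.
  by rewrite kern01 addrAC [p ^ (_ + k)]expfzDr //; ring.
by rewrite S0 mulr0 subr0.
Qed.

(** (p; p)_L times the two [rp] factors is a Gaussian binomial coefficient, so this is the
    q-binomial theorem. The induction strips the first factor of the product, replacing z by z p. *)
Lemma finite_euler (L n : nat) (q z : K) : p = q ^+ 2 -> (L <= n)%N ->
  poch p p L * \sum_(s < n.+1) q ^+ (s ^ 2) * z ^+ s * (rp (L%:Z - s%:Z) * rp s%:Z)
  = poch (- (z * q)) p L.
Proof.
move=> pq; elim: L z n => [|L IH] z n Ln.
  rewrite !poch0 mul1r (bigD1 ord0) //= big1 ?addr0 => [|i]; last first.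
    rewrite -val_eqE /= => i0; rewrite (@rp_lt0 (_ - _)) ?mul0r ?mulr0 //; lia.
  by rewrite rp0 !mulr1.
case: n Ln => // n Ln.
rewrite [poch (- _) _ _]pochSl opprK pochS -mulrA -exprS.
have -> : - (z * q) * p = - (z * p * q) by ring.
rewrite -(IH _ n) // [in RHS]mulrCA; congr (_ * _).
have e1 : L.+1%:Z - 1 = L%:Z by lia.
(* This uses 1 - p^(L+1) = p^s (1 - p^(L+1-s)) + (1 - p^s). *)
transitivity (\sum_(s < n.+2) (q ^+ (s ^ 2) * (z * p) ^+ s * (rp (L%:Z - s%:Z) * rp s%:Z)
  + q ^+ (s ^ 2) * z ^+ s * (rp (L.+1%:Z - s%:Z) * rp (s%:Z - 1)))).
  rewrite mulr_sumr; apply: eq_bigr => s _.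
  rewrite (_ : L%:Z - s%:Z = L.+1%:Z - s%:Z - 1); last lia.
  rewrite !rp_pred exprMn.
  have [sL|Ls] := leqP s L.+1; last by rewrite (@rp_lt0 (_ - _)) ?(mul0r, mulr0, add0r) //; lia.
  rewrite (_ : L.+1%:Z - s%:Z = (L.+1 - s)%N%:Z); last lia.
  rewrite -!exprnP; have -> : p ^+ L.+1 = p ^+ (L.+1 - s) * p ^+ s by rewrite -exprD subnK.
  ring.
rewrite big_split /= mulrDl mul1r; congr (_ + _).
  rewrite big_ord_recr /= (@rp_lt0 (_ - _)) ?(mul0r, mulr0, addr0) //; lia.
rewrite big_ord_recl /= (@rp_lt0 (0%:Z - 1)) // !(mulr0, mul0r) add0r mulr_sumr.
apply: eq_bigr => s _; rewrite /bump /= add1n.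
have -> : rp (L.+1%:Z - s.+1%:Z) = rp (L%:Z - s%:Z) by congr rp; lia.
have -> : rp (s.+1%:Z - 1) = rp s%:Z by congr rp; lia.
have -> : q ^+ (s.+1 ^ 2) = q * q ^+ (s ^ 2) * p ^+ s.
  by rewrite pq -exprM -exprS -exprD; congr (_ ^+ _); lia.
by rewrite exprMn exprS; ring.
Qed.

End InversePochhammer.
Arguments rp : simpl never.

(** * Theta terms and a finite Jacobi triple product *)

Definition tri (k : int) : int := (k * (k - 1) %/ 2)%Z.

Lemma triE k : tri k * 2 = k * (k - 1).
Proof.
apply/divzK/dvdzP; have k2 := divz_eq k 2; set m := (k %/ 2)%Z in k2.
have [r0|r1] : (k %% 2)%Z = 0 \/ (k %% 2)%Z = 1 by lia.
- by exists (m * (k - 1)); rewrite {1}k2 r0; ring.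
- by exists (m * k); rewrite [X in _ * (X - _)]k2 r1; ring.
Qed.

Lemma tri_succ k : tri (k + 1) = tri k + k.
Proof. have := triE k; have := triE (k + 1); lia. Qed.

Lemma tri_opp k : tri (- k) = tri k + k.
Proof. have := triE k; have := triE (- k); lia. Qed.

Section ThetaTerms.
Variables (K : fieldType).
Implicit Types (z Q : K).

(** For |Q| < 1 the sum over all k is (z, Q/z, Q; Q)_oo. *)
Definition theta_term z Q (k : int) : K := (- z) ^ k * Q ^ (tri k).

Lemma theta_term_succ z Q k : z != 0 -> Q != 0 ->
  theta_term z Q (k + 1) = - z * Q ^ k * theta_term z Q k.
Proof.
move=> z0 Q0; rewrite /theta_term tri_succ !expfzDr ?oppr_eq0 // expr1z; ring.
Qed.

Lemma theta_term_opp z Q k : z != 0 -> Q != 0 ->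
  theta_term z Q (- k) = theta_term (Q / z) Q k.
Proof.
move=> z0 Q0; rewrite /theta_term tri_opp expfzDr //.
by rewrite -mulrN expfzMl -exprz_inv invrN; ring.
Qed.

End ThetaTerms.

Section FiniteTripleProduct.
Variables (K : fieldType) (p z : K).
Hypotheses (p_neq1 : forall n, p ^+ n.+1 != 1) (p0 : p != 0) (z0 : z != 0).
Variable N : nat.
Let v := theta_term z p.
Let J (n : nat) := bsum N (fun k => v k * kern p 0 n%:Z k).
Let H (n : nat) := bsum N (fun k => v k * kern p 1 n%:Z k).

(** J n is written twice through H n and the auxiliary sum Y: directly by [kern01], and by [kern01s]
    after shifting k by one. Eliminating Y leaves a recursion; [triple_odd_even] leads from H n to J
    (n+1) in the same manner. *)
Lemma triple_even_odd n : (n.+1 < N)%N ->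
  (1 - z^-1 * p ^+ n.+1) * J n = (1 - p ^+ n.*2.+1) * H n.
Proof.
move=> nN; pose Y := bsum N (fun k => v k * p ^ k * kern p 1 n%:Z k).
have J1 : J n = H n - p ^+ n.+1 * Y.
  rewrite -bsumZ -bsumB; apply: eq_bsum => k.
  by rewrite kern01 // (_ : n%:Z + k + 1 = n.+1%:Z + k) ?[p ^ (_ + k)]expfzDr // -?exprnP; [ring | lia].
have J2 : J n = - z * (Y - p ^+ n * H n).
  rewrite -bsumZ -bsumB -bsumZ /J -bsum_succ; first last.
  - by rewrite kern_gt ?mulr0 //; lia.
  - by rewrite kern_lt ?mulr0 //; lia.
  apply: eq_bsum => k; rewrite kern01s // /v theta_term_succ //.
  rewrite mulrBl mul1r mulrBr [p ^ (_ - k)]expfzDr // -exprnP.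
  have : p ^ k * p ^ (- k) = 1 by rewrite -expfzDr // subrr.
  move: (p ^ k) (p ^ - k) => x y xy.
  transitivity (- z * (theta_term z p k * x * kern p 1 n k)
    + z * p ^+ n * (theta_term z p k * kern p 1 n k) * (x * y)); first by ring.
  by rewrite xy; ring.
rewrite mulrBl mul1r {1}J1 J2 -addnn -addnS exprS exprD exprS.
by field.
Qed.

Lemma triple_odd_even n : (n.+2 < N)%N ->
  (1 - z * p ^+ n) * H n = (1 - p ^+ n.*2.+2) * J n.+1.
Proof.
move=> nN; pose Y := bsum N (fun k => v k * p ^ (- k) * kern p 0 n.+1%:Z k).
have H1 : H n = J n.+1 - p ^+ n.+1 * Y.
  rewrite -bsumZ -bsumB; apply: eq_bsum => k.
  rewrite kern10 // (_ : n%:Z + 1 = n.+1%:Z) ?[p ^ (_ - k)]expfzDr // -?exprnP; [ring | lia].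
have H2 : H n = - z^-1 * p * (Y - p ^+ n.+1 * J n.+1).
  have -> : H n = bsum N (fun k => v (k - 1) * kern p 1 n%:Z (k - 1)).
    rewrite -[RHS]bsum_succ; first last.
    - by rewrite kern_gt ?mulr0 //; lia.
    - by rewrite kern_lt ?mulr0 //; lia.
    by apply: eq_bsum => k; rewrite addrK.
  rewrite -bsumZ -bsumB -bsumZ; apply: eq_bsum => k; rewrite kern10s //.
  have -> : v k = - z * p ^ (k - 1) * v (k - 1) by rewrite -theta_term_succ // subrK.
  rewrite (_ : n%:Z + 1 = n.+1%:Z) ?[p ^ (_ + k)]expfzDr ?[p ^ (k - 1)]expfzDr // -?exprnP; last lia.
  have : p ^ k * p ^ (- k) = 1 by rewrite -expfzDr // subrr.
  rewrite exprN1; move: (p ^ k) (p ^ - k) => x y xy.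
  transitivity (v (k - 1) * ((x * y) - p ^+ n.+1 * x) * kern p 0 n.+1 k).
    by rewrite xy; ring.
  by field; rewrite p0 z0.
rewrite mulrBl mul1r {1}H1 H2 -doubleS -addnn exprD exprS.
by field.
Qed.

Lemma finite_triple_product n : (n.+1 < N)%N ->
  J n * poch p p n.*2 = poch z p n * poch (p / z) p n.
Proof.
elim: n => [|n IH] nN.
  rewrite !poch0 !mulr1 /J bsum_support0 => [|k k0].
    by rewrite /v /theta_term /tri mul0r div0z /kern !rp0 !expr0z !mulr1.
  have [k1|k1] := ltP 0 k; first by rewrite kern_gt ?mulr0.
  by rewrite kern_lt ?mulr0 //; lia.
have IHn := IH (ltnW nN); rewrite doubleS !pochS -!exprS.
transitivity ((1 - p ^+ n.*2.+2) * J n.+1 * (1 - p ^+ n.*2.+1) * poch p p n.*2).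
  by ring.
rewrite -triple_odd_even //.
transitivity ((1 - z * p ^+ n) * ((1 - p ^+ n.*2.+1) * H n) * poch p p n.*2).
  by ring.
rewrite -triple_even_odd ?(ltnW nN) //.
transitivity ((1 - z * p ^+ n) * (1 - z^-1 * p ^+ n.+1) * (J n * poch p p n.*2)).
  by ring.
by rewrite IHn exprS; field.
Qed.

End FiniteTripleProduct.

(** * The Bailey pairs with coefficients (-1)^k q^(k(k-1)/2) in base q^2 *)

Section BaileyPair.
Variables (K : fieldType) (q : K).
Hypotheses (q_neq1 : forall n, q ^+ n.+1 != 1) (q0 : q != 0).
Let p := q ^+ 2.
Let w := theta_term 1 q.

Lemma sqr_neq1 n : p ^+ n.+1 != 1.
Proof. by clear q0; rewrite -exprM (_ : (2 * n.+1 = n.*2.+1.+1)%N) //; lia. Qed.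

Lemma sqr_neq0 : p != 0. Proof. by rewrite expf_neq0. Qed.

Lemma one_plus_neq0 n : 1 + q ^+ n.+1 != 0.
Proof.
apply: contraNneq (sqr_neq1 n) => /eqP; rewrite addrC addr_eq0 => /eqP qn.
by rewrite -exprM mulnC exprM qn sqrrN expr1n.
Qed.

Let w_succ k : w (k + 1) = - q ^ k * w k.
Proof. by rewrite /w theta_term_succ ?oner_neq0 // mulN1r. Qed.

Let w_opp k : w (- k) = q ^ k * w k.
Proof.
by rewrite /w theta_term_opp ?oner_neq0 // divr1 /theta_term -mulN1r expfzMl; ring.
Qed.

Let p_expz k : p ^ k = q ^ k * q ^ k.
Proof. by rewrite -expfzMl. Qed.

Let qk0 k : q ^ k != 0. Proof. by rewrite expfz_neq0. Qed.

Let A N n := bsum N (fun k => w k * kern p 0 n%:Z k).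
Let G N n := bsum N (fun k => w k * kern p 1 n%:Z k).

(** The reflection k -> -k-1 fixes [kern p 1] and multiplies w k by -q p^k. *)
Lemma pair_odd_refl N n : (n.+1 < N)%N ->
  - q * bsum N (fun k => w k * p ^ k * kern p 1 n%:Z k) = G N n.
Proof.
move=> nN; rewrite -bsumZ -[LHS]bsum_refl1.
- apply: eq_bsum => k; rewrite kern1_refl mulrA; congr (_ * _).
  have -> : - k - 1 = - (k + 1) by lia.
  rewrite w_opp w_succ p_expz -!invr_expz expfzDr // expr1z.
  by field; rewrite q0 qk0.
- by rewrite kern_gt ?mulr0 //; lia.
- by rewrite kern_lt ?mulr0 //; lia.
Qed.

Lemma pair_even_of_odd N n : (n.+1 < N)%N -> A N n = (1 + q ^+ n.*2.+1) * G N n.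
Proof.
move=> nN.
transitivity (G N n - p ^+ n.+1 * bsum N (fun k => w k * p ^ k * kern p 1 n%:Z k)).
  rewrite -bsumZ -bsumB; apply: eq_bsum => k.
  rewrite kern01; last exact: sqr_neq1.
  by rewrite addrAC [p ^ (_ + k)]expfzDr ?sqr_neq0 // (_ : n%:Z + 1 = n.+1%:Z) -?exprnP; [ring | lia].
by rewrite -pair_odd_refl // /p -exprM mulnC muln2 doubleS !exprS; ring.
Qed.

(** X s is the sum for A at n+1 with an extra weight q^(ks). Since w (-k) = q^k w k, the reflection
    k -> -k exchanges X s and X (1-s). The shift relation [kern00s] ties X 0 to X 2, and then both
    sides are multiples of X 2. *)
Lemma pair_odd_of_even N n : 2%:R != 0 :> K -> (n.+2 < N)%N ->
  (1 - q ^+ (4 * n.+1)) * A N n.+1 = - q ^+ n.*2.+1 * G N n.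
Proof.
move=> K2 nN; pose X (s : int) := bsum N (fun k => w k * (q ^ k) ^ s * kern p 0 n.+1%:Z k).
have p_n1 := sqr_neq1; have p0 := sqr_neq0.
have X0 : A N n.+1 = X 0 by apply: eq_bsum => k; rewrite expr0z mulr1.
have X1 : X 1 = X 0.
  rewrite /X -[LHS]bsum_opp; apply: eq_bsum => k.
  rewrite kern0_opp w_opp !expr1z expr0z mulr1 -invr_expz.
  by congr (_ * _); rewrite mulrC mulrA mulVf ?mul1r.
have X2 : X 2 = X (- 1).
  rewrite /X -[LHS]bsum_opp; apply: eq_bsum => k.
  rewrite kern0_opp w_opp -invr_expz.
  have -> : (q ^ k)^-1 ^ 2 = (q ^ k)^-1 * (q ^ k)^-1 by [].
  by rewrite exprN1; congr (_ * _); field.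
have P2 : X 0 = p ^+ n.+1 * X 2.
  (* By the two reflections the difference on the left equals the one on the right before its sign,
     so it vanishes because 2 is nonzero. *)
  have : X 1 - p ^+ n.+1 * X (- 1) = - (X 0 - p ^+ n.+1 * X 2).
    transitivity (bsum N (fun k => w k * q ^ k * ((1 - p ^ (n.+1%:Z - k)) * kern p 0 n.+1 k))).
      rewrite /X -bsumZ -bsumB; apply: eq_bsum => k.
      rewrite expfzDr // -exprnP -invr_expz p_expz expr1z exprN1.
      by field.
    pose F k := - w k * (1 - p ^ (n.+1%:Z + k)) * kern p 0 n.+1 k.
    transitivity (bsum N F).
      rewrite -[RHS]bsum_succ /F; first last.
      - by rewrite kern_gt ?mulr0 //; lia.
      - by rewrite kern_lt ?mulr0 //; lia.
      by apply: eq_bsum => k; rewrite w_succ -kern00s // addrA; ring.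
    rewrite /X -mulN1r -bsumZ -bsumB -bsumZ; apply: eq_bsum => k.
    rewrite /F expfzDr // -exprnP expr0z mulr1 p_expz.
    by rewrite -[(q ^ k) ^ 2]/(q ^ k * q ^ k); ring.
  rewrite X1 -X2 => /eqP; rewrite -subr_eq0 opprK -mulr2n -[_ *+ 2]mulr_natl.
  by rewrite mulf_eq0 (negPf K2) subr_eq0 => /eqP.
have -> : G N n = - q * (X 2 - p ^+ n.+1 * X 0).
  rewrite -pair_odd_refl ?(ltnW nN) //; congr (_ * _).
  rewrite /X -bsumZ -bsumB; apply: eq_bsum => k.
  rewrite kern10 // (_ : n%:Z + 1 = n.+1%:Z); last lia.
  rewrite expfzDr // -exprnP -invr_expz p_expz expr0z.
  rewrite -[(q ^ k) ^ 2]/(q ^ k * q ^ k).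
  by field.
rewrite X0 P2 (_ : q ^+ (4 * n.+1) = p ^+ n.+1 * p ^+ n.+1).
  have -> : p ^+ n.+1 = q * q ^+ n.*2.+1 by rewrite /p -exprM -exprS; congr (_ ^+ _); lia.
  ring.
by rewrite /p -!exprM -exprD; congr (_ ^+ _); lia.
Qed.

Lemma pair_even0 N : A N 0 = 1.
Proof.
rewrite /A bsum_support0 => [|k k0].
  by rewrite /w /theta_term /tri mul0r div0z /kern !rp0 !expr0z !mulr1.
have [k1|k1] := ltP 0 k; first by rewrite kern_gt ?mulr0.
by rewrite kern_lt ?mulr0 //; lia.
Qed.

(** A at 0 is 1, and the two recursions alternate from A at n to G at n to A at n+1, which
    determines both sequences. *)
Lemma bailey_pair N n : 2%:R != 0 :> K -> (n.+1 < N)%N ->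
  bsum N (fun k => w k * kern p 0 n%:Z k) =
    (-1) ^+ n * q ^+ (n ^ 2) / (poch (p ^+ 2) (p ^+ 2) n * poch (- q) p n) /\
  bsum N (fun k => w k * kern p 1 n%:Z k) =
    (-1) ^+ n * q ^+ (n ^ 2) / (poch (p ^+ 2) (p ^+ 2) n * poch (- q) p n.+1).
Proof.
move=> K2; rewrite -/(A N n) -/(G N n).
have AG m : (m.+1 < N)%N -> A N m =
    (-1) ^+ m * q ^+ (m ^ 2) / (poch (p ^+ 2) (p ^+ 2) m * poch (- q) p m) ->
    G N m = (-1) ^+ m * q ^+ (m ^ 2) / (poch (p ^+ 2) (p ^+ 2) m * poch (- q) p m.+1).
  move=> mN; rewrite pair_even_of_odd // => Am.
  have qm : 1 + q ^+ m.*2.+1 != 0 by exact: one_plus_neq0.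
  have e : q * p ^+ m = q ^+ m.*2.+1 by rewrite /p -exprM mul2n exprS.
  rewrite pochS mulNr opprK e [X in _ / X]mulrA [in RHS]invfM mulrA -Am.
  by rewrite mulrC mulrA mulVf ?mul1r.
elim: n => [|n IH] nN.
  have A0' : A N 0 = (-1) ^+ 0 * q ^+ (0 ^ 2) / (poch (p ^+ 2) (p ^+ 2) 0 * poch (- q) p 0).
    by rewrite pair_even0 exp0n // !expr0 !poch0 !(mulr1, invr1).
  by split; [exact: A0' | exact: (AG 0%N nN A0')].
have [An Gn] := IH (ltnW nN).
suff An1 : A N n.+1 = (-1) ^+ n.+1 * q ^+ (n.+1 ^ 2) / (poch (p ^+ 2) (p ^+ 2) n.+1 * poch (- q) p n.+1).
  by split; [exact: An1 | exact: (AG n.+1 nN An1)].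
have q4 : 1 - q ^+ (4 * n.+1) != 0 by rewrite subr_eq0 eq_sym (_ : (4 * n.+1 = (4 * n + 3).+1)%N) //; lia.
apply: (mulfI q4); rewrite pair_odd_of_even // Gn.
have e : p ^+ 2 * (p ^+ 2) ^+ n = q ^+ (4 * n.+1).
  by rewrite /p -exprS -!exprM mulnA.
rewrite [poch _ _ n.+1 in RHS]pochS e.
rewrite (_ : (n.+1 ^ 2 = n.*2.+1 + n ^ 2)%N); last lia.
rewrite [q ^+ (_ + _)]exprD [(-1) ^+ n.+1]exprS !invfM.
set a := (poch _ _ n)^-1; set b := (poch _ _ _)^-1.
by field.
Qed.

End BaileyPair.

(** * The Bailey chain *)

Section IteratedSums.
Variable V : nmodType.
Implicit Types (F G : seq nat -> V).

(** Indexing by sequences lets recursion on the head remove the outermost variable of the chain;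
    [big_ffun_msum] returns to finite functions. *)
Fixpoint msum (s B : nat) F : V :=
  if s is s'.+1 then \sum_(x < B) msum s' B (fun l => F (val x :: l)) else F [::].

Lemma msumS s B F :
  msum s.+1 B F = \sum_(x < B) msum s B (fun l => F (val x :: l)).
Proof. by []. Qed.

Lemma eq_msum s B F G : (forall l, size l = s -> F l = G l) -> msum s B F = msum s B G.
Proof.
elim: s F G => [|s IH] F G FG /=; first exact: FG.
by apply: eq_bigr => x _; apply: IH => l ls; apply: FG; rewrite /= ls.
Qed.

Lemma msum_exchange s B C (F : 'I_C -> seq nat -> V) :
  msum s B (fun l => \sum_(x < C) F x l) = \sum_(x < C) msum s B (F x).
Proof.
elim: s F => [//|s IH] F /=; rewrite exchange_big /=.
by apply: eq_bigr => y _; rewrite IH.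
Qed.

Lemma big_ffun_msum r B F :
  \sum_(g : {ffun 'I_r -> 'I_B}) F [seq val (g i) | i <- enum 'I_r] = msum r B F.
Proof.
elim: r F => [|r IH] F /=.
  rewrite (bigD1 (ffun0 (card_ord 0))) //= big1 => [|g]; last first.
    by case/eqP; apply/ffunP => -[].
  by rewrite addr0; congr F; apply/size0nil; rewrite size_map size_enum_ord.
pose h (xg : 'I_B * {ffun 'I_r -> 'I_B}) : {ffun 'I_r.+1 -> 'I_B} :=
  [ffun i => if unlift ord0 i is Some j then xg.2 j else xg.1].
pose h' (g : {ffun 'I_r.+1 -> 'I_B}) := (g ord0, [ffun j => g (lift ord0 j)]).
rewrite (reindex h) /=; last first.
  exists h' => [[x g]|g] _.
    by congr pair; [|apply/ffunP => j]; rewrite !ffunE ?unlift_none ?liftK.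
  apply/ffunP => i; rewrite !ffunE; case: unliftP => [j|] -> //.
  by rewrite ffunE.
rewrite -(pair_bigA _ (fun x g => F [seq val (h (x, g) i) | i <- enum 'I_r.+1])) /=.
apply: eq_bigr => x _; rewrite -IH; apply: eq_bigr => g _; congr F.
rewrite enum_ordSl /= ffunE unlift_none /= -map_comp; congr cons.
by apply: eq_map => j /=; rewrite ffunE liftK.
Qed.

End IteratedSums.

Lemma msumZ (K : pzRingType) s B (c : K) F :
  msum s B (fun l => c * F l) = c * msum s B F.
Proof.
elim: s F => [//|s IH] F /=; rewrite mulr_sumr.
by apply: eq_bigr => x _; rewrite IH.
Qed.

(** The substitution m = x + a on a fixed window: terms pushed past B vanish through f, and those
    with m < a through g. *)
Lemma sum_shift (K : pzRingType) (B a : nat) (f g : int -> K) :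
  (forall m, B%:Z <= m -> f m = 0) -> (forall m, m < 0 -> g m = 0) ->
  \sum_(x < B) f (x%:Z + a%:Z) * g x%:Z = \sum_(m < B) f m%:Z * g (m%:Z - a%:Z).
Proof.
move=> f0 g0; have [aB|Ba] := leqP a B; last first.
  rewrite [LHS]big1 => [|x _]; last by rewrite f0 ?mul0r //; lia.
  by rewrite big1 // => x _; rewrite g0 ?mulr0 //; have := ltn_ord x; lia.
rewrite -(big_mkord xpredT (fun m => f m%:Z * g (m%:Z - a%:Z))).
rewrite (@big_cat_nat _ _ _ a) //= [X in X + _]big_nat.
rewrite [X in X + _]big1 => [|m ma]; last by rewrite g0 ?mulr0 //; lia.
rewrite add0r -[X in \sum_(X <= _ < _) _]add0n big_addn.
rewrite -(big_mkord xpredT (fun x => f (x%:Z + a%:Z) * g x%:Z)).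
rewrite (@big_cat_nat _ _ _ (B - a)) ?leq_subr //= [X in _ + X]big_nat.
rewrite [X in _ + X]big1 ?addr0 => [|m mB]; last by rewrite f0 ?mul0r //; lia.
by apply: eq_bigr => m _; rewrite PoszD addrK.
Qed.

Section Chain.
Variables (K : fieldType) (p : K).
Hypotheses (p_neq1 : forall n, p ^+ n.+1 != 1) (p0 : p != 0).

(* The summand of a Bailey chain ending in [beta], indexed by the differences
   [n_2, ..., n_r] of consecutive variables [N_k = n_k + ... + n_r]; the factor
   attached to the outermost [N_2] is left out. *)
Fixpoint chain (beta : nat -> K) (lam : nat -> nat) (l : seq nat) : K :=
  if l is x :: l' then
    if l' is [::] then beta x
    else rp p x * p ^+ (sumn l' ^ 2 + lam (size l') * sumn l') * chain beta lam l'
  else 1.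

Lemma eq_chain b b' lam l : b =1 b' -> chain b lam l = chain b' lam l.
Proof.
move=> bb; elim: l => [//|x [_|y l IH]]; first by rewrite /= bb.
by rewrite [LHS]/= [RHS]/= -!/(chain _ _ (y :: l)) IH.
Qed.

Lemma chain_scale (h beta : nat -> K) lam l : l != [::] ->
  chain (fun m => h m * beta m) lam l = h (last 0%N l) * chain beta lam l.
Proof.
elim: l => [//|x [//|y l] IH] _.
rewrite [LHS]/= [RHS]/=.
by rewrite -!/(chain _ _ (y :: l)) IH //=; ring.
Qed.

Variables (lam : nat -> nat) (beta : nat -> K) (B : nat).

(** For s > 0, the n-th term after s applications of Bailey's lemma to [beta]; the factors in front
    restore what [chain] omits for its outermost variable. *)
Definition chain_sum s (n : nat) := msum s B (fun l =>
  rp p (n%:Z - (sumn l)%:Z) * p ^+ (sumn l ^ 2 + lam s * sumn l) * chain beta lam l).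

(** The outermost difference x is replaced by the variable m = x + [sumn l]. Its factor [rp p x]
    becomes [rp p (m - sumn l)], with which the inner [chain_sum] starts. *)
Lemma chain_sum_succ s n : (n < B)%N ->
  chain_sum s.+2 n =
  \sum_(m < B) p ^+ (m ^ 2 + lam s.+2 * m) * (rp p (n%:Z - m%:Z) * chain_sum s.+1 m).
Proof.
move=> nB; rewrite /chain_sum.
transitivity (msum s.+1 B (fun l => \sum_(x < B)
   (rp p (n%:Z - (x%:Z + (sumn l)%:Z))
     * p ^+ (`|x%:Z + (sumn l)%:Z| ^ 2 + lam s.+2 * `|x%:Z + (sumn l)%:Z|)) *
   rp p x * (p ^+ (sumn l ^ 2 + lam s.+1 * sumn l) * chain beta lam l))).
  rewrite msumS msum_exchange; apply: eq_bigr => x _; apply: eq_msum => l ls.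
  case: l ls => // y l [ls]; rewrite [sumn _]/= -PoszD /= ls; ring.
under eq_bigr do rewrite mulrA -msumZ.
rewrite -msum_exchange; apply: eq_msum => l ls.
rewrite -mulr_suml.
rewrite (@sum_shift _ B (sumn l) (fun m => rp p (n%:Z - m) * p ^+ (`|m| ^ 2 + lam s.+2 * `|m|)) (rp p)).
- by rewrite mulr_suml; apply: eq_bigr => m _; rewrite absz_nat; ring.
- by move=> m mB; rewrite (@rp_lt0 _ _ (_ - _)) ?mul0r //; lia.
- by move=> m; exact: rp_lt0.
Qed.

Lemma bailey_step (a n : nat) (c : int -> K) (u : nat -> K) : (a <= 1)%N -> (n < B)%N ->
  (forall m, (m < B)%N -> u m = bsum B.+1 (fun k => c k * kern p a m%:Z k)) ->
  \sum_(m < B) p ^+ (m ^ 2 + a * m) * (rp p (n%:Z - m%:Z) * u m) =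
  bsum B.+1 (fun k => c k * p ^ (k ^+ 2 + a%:Z * k) * kern p a n%:Z k).
Proof.
move=> a1 nB uE.
transitivity (\sum_(m < B) bsum B.+1 (fun k => c k *
  (p ^ (m%:Z ^+ 2 + a%:Z * m%:Z) * (rp p (n%:Z - m%:Z) * kern p a m%:Z k)))).
  apply: eq_bigr => m _; rewrite uE // mulrA -bsumZ; apply: eq_bsum => k.
  rewrite exprnP (_ : (m ^ 2 + a * m)%N%:Z = m%:Z ^+ 2 + a%:Z * m%:Z); last lia.
  ring.
have kb k : \sum_(m < B) p ^ (m%:Z ^+ 2 + a%:Z * m%:Z) * (rp p (n%:Z - m%:Z) * kern p a m%:Z k)
    = p ^ (k ^+ 2 + a%:Z * k) * kern p a n%:Z k.
  by move: nB; clear uE; case: (B) => // B' nB; exact: kern_bailey.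
rewrite /bsum exchange_big /=; apply: eq_bigr => i _.
by rewrite -mulr_sumr kb mulrA.
Qed.

Lemma chain_sum_step (a s : nat) (c : int -> K) : (a <= 1)%N -> lam s.+2 = a ->
  (forall m, (m < B)%N -> chain_sum s.+1 m = bsum B.+1 (fun k => c k * kern p a m%:Z k)) ->
  forall n, (n < B)%N ->
  chain_sum s.+2 n = bsum B.+1 (fun k => c k * p ^ (k ^+ 2 + a%:Z * k) * kern p a n%:Z k).
Proof.
by move=> a1 lams cs n nB; rewrite chain_sum_succ // lams; exact: bailey_step.
Qed.

Lemma chain_sum1 (a : nat) (c : int -> K) : (a <= 1)%N -> lam 1 = a ->
  (forall m, (m < B)%N -> beta m = bsum B.+1 (fun k => c k * kern p a m%:Z k)) ->
  forall n, (n < B)%N ->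
  chain_sum 1 n = bsum B.+1 (fun k => c k * p ^ (k ^+ 2 + a%:Z * k) * kern p a n%:Z k).
Proof.
move=> a1 lam1 cs n nB; rewrite -(bailey_step a1 nB cs); apply: eq_bigr => m _ /=.
by rewrite addn0 lam1; ring.
Qed.

End Chain.

(** * Evaluation of the two chains and summation over n_1 *)

Section Evaluation.
Variables (K : fieldType) (q : K).
Hypotheses (q_neq1 : forall n, q ^+ n.+1 != 1) (q0 : q != 0) (K2 : 2%:R != 0 :> K).
Let p := q ^+ 2.
Let p0 : p != 0 := sqr_neq0 q0.
Let p_neq1 : forall n, p ^+ n.+1 != 1 := sqr_neq1 q_neq1.

Definition beta (d m : nat) : K :=
  (-1) ^+ m * q ^+ (m ^ 2) / (poch (p ^+ 2) (p ^+ 2) m * poch (- q) p (m + d)).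

(** All coefficient sequences of the chain have this shape, so only the exponent h is tracked; a
    Bailey step adds 2(k^2 + a k) to it. *)
Definition coef (h : int -> int) (k : int) : K := (-1) ^ k * q ^ h k.

Lemma eq_coef h h' k : h k = h' k -> coef h k = coef h' k.
Proof. by rewrite /coef => ->. Qed.

Lemma coef_mulp h k m : coef h k * p ^ m = coef (fun k => h k + 2 * m) k.
Proof. by rewrite /coef /p exprnP exprz_exp expfzDr // mulrA. Qed.

Lemma coef_theta (m Q : nat) k :
  theta_term (q ^+ m) (q ^+ Q) k = coef (fun k => m%:Z * k + Q%:Z * tri k) k.
Proof.
rewrite /theta_term /coef expfzDr // mulrA -[- (q ^+ m)]mulN1r expfzMl.
by rewrite !exprnP !exprz_exp.
Qed.

Lemma signz_opp k : (-1) ^ (- k) = (-1) ^ k :> K.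
Proof. by rewrite -exprz_inv invrN1. Qed.

(** By hypothesis the exponents of c_k p^k agree at k and -k-1; the sign (-1)^k then supplies the
    antisymmetry. *)
Lemma coef_switch h n B : (n < B)%N ->
  (forall k, h (- k - 1) - 2 * k - 2 = h k + 2 * k) ->
  bsum B.+1 (fun k => coef h k * kern p 0 n%:Z k) =
  bsum B.+1 (fun k => coef h k * kern p 1 n%:Z k).
Proof.
move=> nB hk; apply: bsum_kern01 => // k.
rewrite !coef_mulp /coef -(hk k) -[RHS]mulNr; congr (_ * q ^ _); last by lia.
have -> : - k - 1 = - (k + 1) by lia.
by rewrite signz_opp expfzDr ?oppr_eq0 ?oner_eq0 // expr1z mulrN1.
Qed.

Lemma chain_sum_odd s n B : (n < B)%N ->
  chain_sum p (fun=> 1%N) (beta 1) B s.+1 n =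
  bsum B.+1 (fun k => coef (fun k => tri k + 2 * s.+1%:Z * (k ^+ 2 + k)) k * kern p 1 n%:Z k).
Proof.
elim: s n => [|s IH] n nB.
  rewrite (chain_sum1 p_neq1 p0 (a := 1%N) (c := coef tri)) //.
    by apply: eq_bsum => k; rewrite coef_mulp; congr (_ * _); apply: eq_coef; ring.
  move=> m mB; have [_ /esym] := @bailey_pair _ _ q_neq1 q0 B.+1 m K2 mB.
  rewrite /beta addn1 => ->; apply: eq_bsum => k.
  by rewrite /theta_term /coef.
rewrite (chain_sum_step p_neq1 p0 (a := 1%N) isT _ IH) //.
apply: eq_bsum => k; rewrite coef_mulp; congr (_ * _); apply: eq_coef.
by rewrite [s.+2%:Z]intS; ring.
Qed.

(** Here t is the length r-k+1 of [n_k, ..., n_r], so for s1 = r-i this is the indicator of i < k <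
    r. *)
Definition lam_mid (s1 t : nat) : nat := (1 < t <= s1)%N.

Lemma chain_sum_even1 s1 s n B : (n < B)%N -> (s < s1)%N ->
  chain_sum p (lam_mid s1) (beta 0) B s.+1 n =
  bsum B.+1 (fun k => coef (fun k => tri k + k + 2 * k ^+ 2 + 2 * s%:Z * (k ^+ 2 + k)) k * kern p 1 n%:Z k).
Proof.
elim: s n => [|s IH] n nB ss.
  rewrite (chain_sum1 p_neq1 p0 (a := 0%N) (c := coef tri)) //; first last.
    move=> m mB; have [/esym + _] := @bailey_pair _ _ q_neq1 q0 B.+1 m K2 mB.
    rewrite /beta addn0 => ->; apply: eq_bsum => k.
    by rewrite /theta_term /coef.
  (* The exponent [tri k] + 2k^2 does not satisfy the switch condition, but its image [tri k] + k +
     2k^2 under k -> -k does. *)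
  rewrite -coef_switch // => [|k].
    rewrite -[LHS]bsum_opp; apply: eq_bsum => k; rewrite kern0_opp coef_mulp.
    rewrite /coef tri_opp signz_opp; congr (_ * q ^ _ * _).
    ring.
  have -> : - k - 1 = - (k + 1) by lia.
  by rewrite tri_opp tri_succ; ring.
rewrite (chain_sum_step p_neq1 p0 (a := 1%N) isT _ (fun m mB => IH m mB (ltnW ss))) //; last first.
  by rewrite /lam_mid ltnS ss.
apply: eq_bsum => k; rewrite coef_mulp; congr (_ * _); apply: eq_coef.
by rewrite [s.+1%:Z]intS; ring.
Qed.

Lemma chain_sum_even s1 t n B : (n < B)%N -> (0 < s1)%N ->
  chain_sum p (lam_mid s1) (beta 0) B (t + s1) n =
  bsum B.+1 (fun k => coef (fun k => tri k + k + 2 * k ^+ 2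
     + 2 * (s1%:Z - 1) * (k ^+ 2 + k) + 2 * t%:Z * k ^+ 2) k * kern p 0 n%:Z k).
Proof.
case: s1 => // s1 nB _; elim: t n nB => [|t IH] n nB.
  (* The steps relative to p add multiples of k^2 + k, which is invariant under k -> -k-1, so the
     switch condition persists. *)
  rewrite chain_sum_even1 // -coef_switch // => [|k].
    by apply: eq_bsum => k; congr (_ * _); apply: eq_coef; rewrite intS; ring.
  have -> : - k - 1 = - (k + 1) by lia.
  by rewrite tri_opp tri_succ; ring.
rewrite addnS in IH; rewrite addSn addnS.
rewrite (chain_sum_step p_neq1 p0 (a := 0%N) isT _ IH) //; last first.
  by rewrite /lam_mid; apply/eqP; rewrite eqb0; lia.
apply: eq_bsum => k; rewrite coef_mulp; congr (_ * _); apply: eq_coef.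
by rewrite [t.+1%:Z]intS; ring.
Qed.

(** The signed Nahm summand without q^(2c_i), with x = n_1 and l = [n_2, ..., n_r]; [last 0 l] is
    n_r. *)
Definition body (d : nat) (lam : nat -> nat) (x : nat) (l : seq nat) : K :=
  q ^+ ((x + last 0%N l) ^ 2 + 2 * d * x) * rp p x * p ^+ (sumn l ^ 2 + lam (size l) * sumn l)
  * chain p (fun m => (-1) ^+ m / poch (p ^+ 2) (p ^+ 2) m) lam l.

(* Bounded weights tending to 1 that turn the sum into a finite one without
   spoiling the summation formulas. *)
Definition weight (M x : nat) (l : seq nat) : K :=
  poch p p (M - last 0%N l) * rp p (M%:Z - (last 0%N l)%:Z - x%:Z)
  * (poch p p M * rp p (M%:Z - (sumn l)%:Z)).

Lemma last_le_sumn l : (last 0 l <= sumn l)%N.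
Proof.
case: l => // x l; elim: l x => [|y l IH] x /=; first by rewrite addn0.
by rewrite (leq_trans (IH y)) // leq_addl.
Qed.

Lemma poch_cat (a t : K) m n : poch a t (m + n) = poch a t m * poch (a * t ^+ m) t n.
Proof.
elim: n => [|n IH]; first by rewrite addn0 poch0 mulr1.
by rewrite addnS !pochS IH exprD -!mulrA.
Qed.

Lemma poch_Nq_neq0 n : poch (- q) p n != 0.
Proof.
elim: n => [|n IH]; first by rewrite poch0 oner_neq0.
rewrite pochS mulf_neq0 // mulNr opprK /p -exprM -exprS.
by rewrite one_plus_neq0.
Qed.

(** The first half of the weight turns the sum over x into [finite_euler] with L = M - n_r and z =
    q^(2(n_r+d)). Its value is (-q; p)_(M+d) / (-q; p)_(n_r+d), whose denominator completes
    [beta d]. The second half provides the factor [rp p (M - sumn l)] of [chain_sum]. *)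
Lemma weighted_sum d lam s M B : (M < B)%N ->
  msum s.+2 B (fun l => weight M (head 0%N l) (behead l) * body d lam (head 0%N l) (behead l))
  = poch (- q) p (M + d) * poch p p M * chain_sum p lam (beta d) B s.+1 M.
Proof.
clear K2 => MB; rewrite msumS -msum_exchange -msumZ; apply: eq_msum => l ls /=.
have l0 : l != [::] by case: (l) ls.
set m := last 0%N l; have ml : (m <= sumn l)%N := last_le_sumn l.
have [lM|Ml] := leqP (sumn l) M; last first.
  have r0 : rp p (M%:Z - (sumn l)%:Z) = 0 by rewrite rp_lt0 //; lia.
  by rewrite r0 big1 => [|x _]; rewrite /weight ?r0 !(mulr0, mul0r).
have mM : (m <= M)%N := leq_trans ml lM.
pose z := q ^+ (2 * (m + d)).
have bE : beta d =1 fun k =>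
    (q ^+ (k ^ 2) / poch (- q) p (k + d)) * ((-1) ^+ k / poch (p ^+ 2) (p ^+ 2) k).
  by move=> k; rewrite /beta invfM; ring.
rewrite (eq_chain _ _ _ bE) chain_scale // -/m.
transitivity ((\sum_(x < B) poch p p (M - m)
    * (q ^+ (x ^ 2) * z ^+ x * (rp p ((M - m)%N%:Z - x%:Z) * rp p x%:Z)))
  * (q ^+ (m ^ 2) * (poch p p M * rp p (M%:Z - (sumn l)%:Z)) *
     (p ^+ (sumn l ^ 2 + lam (size l) * sumn l)
  * chain p (fun m => (-1) ^+ m / poch (p ^+ 2) (p ^+ 2) m) lam l))).
  rewrite mulr_suml; apply: eq_bigr => x _.
  rewrite /weight /body -/m subzn //.
  have -> : q ^+ ((x + m) ^ 2 + 2 * d * x) = q ^+ (x ^ 2) * z ^+ x * q ^+ (m ^ 2).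
    by rewrite /z -exprM -!exprD; congr (_ ^+ _); lia.
  ring.
rewrite -mulr_sumr.
have -> : poch p p (M - m) * (\sum_(x < B) q ^+ (x ^ 2) * z ^+ x
      * (rp p ((M - m)%N%:Z - x%:Z) * rp p x%:Z))
   = poch (- (z * q)) p (M - m).
  by case: (B) MB => // n Mn; apply: (finite_euler p_neq1) => //; lia.
have -> : poch (- q) p (M + d) = poch (- q) p (m + d) * poch (- (z * q)) p (M - m).
  rewrite (_ : (M + d = m + d + (M - m))%N) ?poch_cat; last lia.
  by rewrite (_ : z * q = q * p ^+ (m + d)) ?mulNr // /z exprM mulrC.
rewrite ls; have := poch_Nq_neq0 (m + d); set P := poch (- q) p (m + d) => P0.
by field.
Qed.

End Evaluation.

(** * Dominated convergence and infinite products *)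

Section UnorderedSums.
Local Open Scope classical_set_scope.
Variables (R : realType) (T : choiceType).
Implicit Types (G : T -> R) (s A : seq T) (e : R).

Lemma big_uniq_sub (V : nmodType) (F : T -> V) s A : uniq s -> uniq A ->
  {subset A <= s} ->
  \sum_(t <- s) F t = \sum_(t <- A) F t + \sum_(t <- s | t \notin A) F t.
Proof.
move=> us uA As; rewrite (bigID (mem A)) /=; congr (_ + _).
rewrite -big_filter; apply: perm_big; apply: uniq_perm; rewrite ?filter_uniq //.
move=> t; rewrite mem_filter; apply/andP/idP => [[] //|tA]; split => //.
exact: As.
Qed.

Definition bounded_sums G :=
  (forall t, 0 <= G t) /\ exists b, forall s, uniq s -> \sum_(t <- s) G t <= b.

Lemma bounded_sums_sup G : bounded_sums G ->
  exists S : R, (forall s, uniq s -> \sum_(t <- s) G t <= S) /\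
  forall e, 0 < e -> exists2 A, uniq A & S - e < \sum_(t <- A) G t.
Proof.
move=> [G0 [b Gb]].
pose E := [set x : R | exists2 s, uniq s & x = \sum_(t <- s) G t].
have E0 : E !=set0 by exists 0, [::]; rewrite ?big_nil.
have Eb : has_ubound E by exists b => _ [s us ->]; exact: Gb.
exists (sup E); split=> [s us|e e0].
  by apply: (ub_le_sup Eb); exists s.
by have [|_ [A uA ->]] := sup_adherent e0 (E := E) => // ; exists A.
Qed.

Lemma bounded_sums_tail G e : bounded_sums G -> 0 < e ->
  exists2 A, uniq A & forall s, uniq s -> {in s, forall t, t \notin A} -> \sum_(t <- s) G t < e.
Proof.
move=> Gb e0; have [S [GS]] := bounded_sums_sup Gb => /(_ _ e0)[A uA SA].
exists A => // s us sA.
have : \sum_(t <- A ++ s) G t <= S.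
  apply: GS; rewrite cat_uniq uA us andbT /=; apply/hasPn => t ts; exact: sA.
rewrite big_cat /=; lra.
Qed.

Lemma bounded_sums_cvg G : bounded_sums G -> exists S : R, forall e, 0 < e ->
  exists2 A, uniq A & forall s, uniq s -> {subset A <= s} -> `|\sum_(t <- s) G t - S| < e.
Proof.
move=> Gb; have [S [GS HS]] := bounded_sums_sup Gb; exists S => e e0.
have [A uA SA] := HS _ e0; exists A => // s us As.
have := GS _ us; rewrite (big_uniq_sub _ us uA As).
have : 0 <= \sum_(t <- s | t \notin A) G t by apply: sumr_ge0 => t _; exact: Gb.1.
by move=> ? ?; rewrite ltr_norml; apply/andP; split; lra.
Qed.

Lemma normr_real_complex (x : R) : `|x%:C| = `|x|%:C.
Proof. by rewrite normc_def /= expr0n addr0 sqrtr_sqr. Qed.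

(** Unordered summation with duplicate-free lists as finite sets and a real tolerance; [has_sum_sum]
    identifies the value with [sum]. *)
Definition has_sum (f : T -> R[i]) (S : R[i]) := forall e, 0 < e ->
  exists2 A, uniq A & forall s, uniq s -> {subset A <= s} -> `|\sum_(t <- s) f t - S| < e%:C.

(** g is the difference of g + G and G, two nonnegative families with bounded sums. *)
Lemma real_has_sum (g G : T -> R) : bounded_sums G -> (forall t, `|g t| <= G t) ->
  exists S : R, forall e, 0 < e ->
  exists2 A, uniq A & forall s, uniq s -> {subset A <= s} -> `|\sum_(t <- s) g t - S| < e.
Proof.
move=> Gb gG.
have [S1 H1] := bounded_sums_cvg Gb.
have [|S2 H2] := @bounded_sums_cvg (fun t => g t + G t).
  case: Gb => G0 [b Gb]; split=> [t|].
    by have := gG t; rewrite ler_norml => /andP[]; lra.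
  exists (b + b) => s us; apply: le_trans (lerD (Gb _ us) (Gb _ us)).
  rewrite -big_split /=; apply: ler_sum => t _.
  by have := gG t; rewrite ler_norml => /andP[]; lra.
exists (S2 - S1) => e e0; have e2 : 0 < e / 2 by lra.
have [A1 uA1 HA1] := H1 _ e2; have [A2 uA2 HA2] := H2 _ e2.
exists (undup (A1 ++ A2)); first exact: undup_uniq.
move=> s us As.
have sA1 : {subset A1 <= s} by move=> t tA; apply: As; rewrite mem_undup mem_cat tA.
have sA2 : {subset A2 <= s} by move=> t tA; apply: As; rewrite mem_undup mem_cat tA orbT.
have := HA1 _ us sA1; have := HA2 _ us sA2.
rewrite big_split /= !ltr_norml => /andP[? ?] /andP[? ?].
by apply/andP; split; lra.
Qed.

Lemma norm_le_Re_Im (z : R[i]) : `|z| <= (`|complex.Re z| + `|complex.Im z|)%:C.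
Proof.
rewrite {1}[z]complexE rmorphD /= -!normr_real_complex; apply: le_trans (ler_normD _ _) _.
rewrite lerD2l normrM; suff -> : `|'i%C| = 1 :> R[i] by rewrite mul1r.
by rewrite normc_def /= expr0n expr1n add0r sqrtr1.
Qed.

Lemma Re_le_norm (z : R[i]) (x : R) : `|z| <= x%:C -> `|complex.Re z| <= x.
Proof. by move=> zx; rewrite -lecR; apply: le_trans (normc_ge_Re z) zx. Qed.

Lemma Im_le_norm (z : R[i]) (x : R) : `|z| <= x%:C -> `|complex.Im z| <= x.
Proof.
move=> zx; apply: (@le_trans _ _ `|complex.Re (z * 'i%C)|); first by rewrite ReiNIm normrN.
apply: Re_le_norm; rewrite normrM; suff -> : `|'i%C| = 1 :> R[i] by rewrite mulr1.
by rewrite normc_def /= expr0n expr1n add0r sqrtr1.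
Qed.

Lemma dominated_has_sum (f : T -> R[i]) G : bounded_sums G ->
  (forall t, `|f t| <= (G t)%:C) -> exists S, has_sum f S.
Proof.
move=> Gb fG.
have [|S1 H1] := @real_has_sum (fun t => complex.Re (f t)) G Gb; first by move=> t; exact: Re_le_norm.
have [|S2 H2] := @real_has_sum (fun t => complex.Im (f t)) G Gb; first by move=> t; exact: Im_le_norm.
exists (S1 +i* S2) => e e0; have e2 : 0 < e / 2 by lra.
have [A1 uA1 HA1] := H1 _ e2; have [A2 uA2 HA2] := H2 _ e2.
exists (undup (A1 ++ A2)); first exact: undup_uniq.
move=> s us As.
have sA1 : {subset A1 <= s} by move=> t tA; apply: As; rewrite mem_undup mem_cat tA.
have sA2 : {subset A2 <= s} by move=> t tA; apply: As; rewrite mem_undup mem_cat tA orbT.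
apply: le_lt_trans (norm_le_Re_Im _) _; rewrite ltcR.
have ReS : forall r, complex.Re (\sum_(t <- r) f t) = \sum_(t <- r) complex.Re (f t).
  by move=> r; elim: r => [|t r IH]; rewrite ?big_nil ?big_cons -?IH //; case: (f t) (\sum_(_ <- _) _) => ? ? [].
have ImS : forall r, complex.Im (\sum_(t <- r) f t) = \sum_(t <- r) complex.Im (f t).
  by move=> r; elim: r => [|t r IH]; rewrite ?big_nil ?big_cons -?IH //; case: (f t) (\sum_(_ <- _) _) => ? ? [].
have -> : forall z : R[i], complex.Re (z - (S1 +i* S2)) = complex.Re z - S1 by case.
have -> : forall z : R[i], complex.Im (z - (S1 +i* S2)) = complex.Im z - S2 by case.
rewrite ReS ImS; have := HA1 _ us sA1; have := HA2 _ us sA2; lra.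
Qed.

Lemma gt0_complex (e : R[i]) : 0 < e -> exists2 d : R, 0 < d & e = d%:C.
Proof. by case: e => a b; rewrite ltcE /= => /andP[/eqP -> a0]; exists a. Qed.

Lemma has_sum_sum (f : T -> R[i]) S : has_sum f S -> sum (f : T -> R[i]^o) = S.
Proof.
have FF := @totally_filter T.
move=> fS; apply: cvg_lim; first exact: norm_hausdorff.
apply/cvgrPdistC_lt => e /gt0_complex[d d0 ->].
have [A uA HA] := fS _ d0.
exists [fset t in A]%fset => // B /= AB.
rewrite /partial_sum -(big_seq_fsetE _ _ xpredT f); apply: HA; first exact: fset_uniq.
by move=> t tA; apply: (fsubsetP AB); rewrite inE.
Qed.

Lemma has_sum_seq (f : T -> R[i]) S (s : nat -> seq T) : has_sum f S ->
  (forall M, uniq (s M)) -> (forall t, \forall M \near \oo, t \in s M) ->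
  (fun M => \sum_(t <- s M) f t : R[i]^o) @ \oo --> (S : R[i]^o).
Proof.
move=> fS us cs; apply/cvgrPdistC_lt => e /gt0_complex[d d0 ->].
have [A uA HA] := fS _ d0.
have : \forall M \near \oo, {subset A <= s M}.
  elim: A {uA HA} => [|t A IH]; first by near=> M => t.
  near=> M; have AM : {subset A <= s M} by near: M.
  have tM : t \in s M by near: M; exact: cs.
  by move=> u; rewrite inE => /orP[/eqP ->|/AM].
by move=> H; near=> M; apply: HA => //; near: M.
Unshelve. all: by end_near. Qed.

(** Dominated convergence to 0: outside a finite A the majorant contributes less than d/2 for every
    M, and on A there are finitely many null sequences. *)
Lemma tannery (u : nat -> T -> R[i]) G (s : nat -> seq T) : bounded_sums G ->
  (forall M, uniq (s M)) -> (forall M t, `|u M t| <= (G t)%:C) ->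
  (forall t, (fun M => u M t : R[i]^o) @ \oo --> (0 : R[i]^o)) ->
  (fun M => \sum_(t <- s M) u M t : R[i]^o) @ \oo --> (0 : R[i]^o).
Proof.
move=> Gb us uG u0; apply/cvgrPdistC_lt => e /gt0_complex[d d0 ->].
have d2 : 0 < d / 2 by lra.
have [A uA HA] := bounded_sums_tail Gb d2.
have cA B r : 0 < r -> \forall M \near \oo, \sum_(t <- B) `|u M t| < r%:C.
  elim: B r => [|t B IH] r r0; first by near=> M; rewrite big_nil ltcR.
  have r2 : 0 < r / 2 by lra.
  have r2C : 0 < (r / 2)%:C :> R[i] by rewrite ltcR.
  have /cvgrPdistC_lt/(_ _ r2C) ut := u0 t.
  near=> M; rewrite big_cons (_ : r%:C = (r / 2)%:C + (r / 2)%:C); last first.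
    by rewrite -rmorphD /=; congr (_%:C); lra.
  apply: ltrD; last by near: M; exact: IH.
  have : `|u M t - 0| < (r / 2)%:C by near: M.
  by rewrite subr0.
near=> M; rewrite subr0 (bigID (mem A)) /=.
apply: le_lt_trans (ler_normD _ _) _.
rewrite (_ : d%:C = (d / 2)%:C + (d / 2)%:C); last by rewrite -rmorphD /=; congr (_%:C); lra.
apply: ltrD.
  apply: (@le_lt_trans _ _ (\sum_(t <- A) `|u M t|)); last first.
    by near: M; exact: cA.
  apply: le_trans (ler_norm_sum _ _ _) _.
  rewrite -big_filter.
  rewrite (@big_uniq_sub _ _ A [seq t <- s M | t \in A]) ?filter_uniq //.
    by rewrite lerDl sumr_ge0.
  by move=> t; rewrite mem_filter => /andP[].
apply: le_lt_trans (ler_norm_sum _ _ _) _.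
apply: (@le_lt_trans _ _ (\sum_(t <- s M | t \notin A) (G t)%:C)); first by apply: ler_sum.
rewrite -rmorph_sum /= ltcR -big_filter; apply: HA; first exact: filter_uniq.
by move=> t; rewrite mem_filter => /andP[].
Unshelve. all: by end_near. Qed.

End UnorderedSums.

(** * Geometric majorants and convergence of infinite products *)

Section GeometricSums.
Local Open Scope classical_set_scope.
Variables (R : realType) (x : R).
Hypotheses (x0 : 0 <= x) (x1 : x < 1).

Lemma geometric_le n : \sum_(k < n) x ^+ k <= (1 - x)^-1.
Proof.
have x10 : 0 < 1 - x by rewrite subr_gt0.
rewrite -[leRHS]mul1r ler_pdivlMr // mulrC.
have := subrX1 x n; have := exprn_ge0 n x0; move: (\sum_(k < n) _) (x ^+ n) => S X X0 e; lra.
Qed.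

Lemma geometric_seq_le (s : seq nat) : uniq s -> \sum_(k <- s) x ^+ k <= (1 - x)^-1.
Proof.
move=> us; pose N := (\max_(k <- s) k).+1.
apply: le_trans (geometric_le N); rewrite -(big_mkord xpredT (fun k => x ^+ k)).
rewrite (@big_uniq_sub _ _ _ (index_iota 0 N) s) ?iota_uniq //.
  by rewrite lerDl sumr_ge0 // => k _; rewrite exprn_ge0.
by move=> k ks; rewrite mem_index_iota /= ltnS; exact: leq_bigmax_seq.
Qed.

Lemma geometric_bounded c : 0 <= c -> bounded_sums (fun k : nat => c * x ^+ k).
Proof.
move=> c0; split=> [k|]; first by rewrite mulr_ge0 ?exprn_ge0.
exists (c * (1 - x)^-1) => s us; rewrite -mulr_sumr ler_wpM2l //.
exact: geometric_seq_le.
Qed.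

Lemma geometric_int_bounded c : 0 <= c -> bounded_sums (fun k : int => c * x ^+ `|k|%N).
Proof.
move=> c0; split=> [k|]; first by rewrite mulr_ge0 ?exprn_ge0.
exists (c * ((1 - x)^-1 + (1 - x)^-1)) => s us; rewrite -mulr_sumr ler_wpM2l //.
rewrite (bigID (fun k : int => 0 <= k)) /=; apply: lerD; rewrite -big_filter;
  rewrite -(big_map absz xpredT (fun n => x ^+ n)); apply: geometric_seq_le;
  rewrite map_inj_in_uniq ?filter_uniq // => a b; rewrite !mem_filter => /andP[a0 _] /andP[b0 _]; lia.
Qed.

Lemma geometric_ffun_bounded r c : 0 <= c ->
  bounded_sums (fun n : {ffun 'I_r -> nat} => c * \prod_k x ^+ n k).
Proof.
move=> c0; split=> [n|].
  by rewrite mulr_ge0 // prodr_ge0 // => k _; rewrite exprn_ge0.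
exists (c * (1 - x)^-1 ^+ r) => s us; rewrite -mulr_sumr ler_wpM2l //.
pose N := (\max_(n <- s) \max_k n k).+1.
pose emb (g : {ffun 'I_r -> 'I_N}) : {ffun 'I_r -> nat} := [ffun k => val (g k)].
have emb_inj : injective emb.
  by move=> g h /ffunP gh; apply/ffunP => k; apply: val_inj; have := gh k; rewrite !ffunE.
apply: (@le_trans _ _ (\sum_(g : {ffun 'I_r -> 'I_N}) \prod_k x ^+ g k)).
  have -> : \sum_(g : {ffun 'I_r -> 'I_N}) \prod_k x ^+ g k =
      \sum_(n <- map emb (index_enum _)) \prod_k x ^+ n k.
    by rewrite big_map; apply: eq_bigr => g _; apply: eq_bigr => k _; rewrite ffunE.
  rewrite (@big_uniq_sub _ _ _ (map emb _) s) ?map_inj_uniq ?index_enum_uniq //.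
    by rewrite lerDl sumr_ge0 // => n _; rewrite prodr_ge0 // => k _; rewrite exprn_ge0.
  move=> n ns; have nN k : (n k < N)%N.
    rewrite ltnS; apply: (leq_trans (leq_bigmax (F := fun k => n k) k)).
    exact: (leq_bigmax_seq (F := fun m : {ffun _} => \max_k m k) n ns isT).
  apply/mapP; exists [ffun k => Ordinal (nN k)]; first exact: mem_index_enum.
  by apply/ffunP => k; rewrite !ffunE.
rewrite -(bigA_distr_bigA (fun (_ : 'I_r) (j : 'I_N) => x ^+ j)).
rewrite prodr_const card_ord lerXn2r ?nnegrE ?invr_ge0 ?subr_ge0 ?(ltW x1) //.
  by rewrite sumr_ge0 // => k _; rewrite exprn_ge0.
exact: geometric_le.
Qed.

End GeometricSums.

Section PochhammerBounds.
Local Open Scope classical_set_scope.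
Variables (R : realType) (a p : R[i]) (x y : R).
Hypotheses (px : `|p| = x%:C) (x1 : x < 1) (ay : `|a| = y%:C).

Let x0 : 0 <= x. Proof. by rewrite -ler0c -px. Qed.
Let y0 : 0 <= y. Proof. by rewrite -ler0c -ay. Qed.

Lemma norm_apk k : `|a * p ^+ k| = (y * x ^+ k)%:C.
Proof. by rewrite normrM normrX ay px rmorphM /= rmorphXn. Qed.

Lemma prod_1D_le (f : nat -> R) c n : (forall k, 0 <= f k) ->
  (forall k, f k <= c * x ^+ k) -> 0 <= c -> \prod_(k < n) (1 + f k) <= expR (c / (1 - x)).
Proof.
move=> f0 fc c0; apply: (@le_trans _ _ (expR (\sum_(k < n) f k))).
  rewrite expR_sum; apply: ler_prod => k _.
  by rewrite addr_ge0 ?ler01 //= expR_ge1Dx.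
rewrite ler_expR; apply: (@le_trans _ _ (\sum_(k < n) c * x ^+ k)); first by apply: ler_sum.
by rewrite -mulr_sumr ler_wpM2l // geometric_le.
Qed.

Lemma norm_poch_le n : `|poch a p n| <= (expR (y / (1 - x)))%:C.
Proof.
rewrite /poch normr_prod.
apply: (@le_trans _ _ (\prod_(k < n) (1 + y * x ^+ k))%:C); last first.
  by rewrite lecR; apply: (prod_1D_le (f := fun k => y * x ^+ k)) => // k; rewrite mulr_ge0 ?exprn_ge0.
rewrite rmorph_prod /=; apply: ler_prod => k _; rewrite normr_ge0 /=.
by rewrite rmorphD /= -norm_apk; apply: le_trans (ler_normB _ _) _; rewrite normr1.
Qed.

Lemma poch_factor_neq0 k : y < 1 -> 1 - a * p ^+ k != 0.
Proof.
move=> y1; rewrite subr_eq0; apply/eqP => e.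
have : `|1 : R[i]| = (y * x ^+ k)%:C by rewrite -norm_apk -e.
rewrite normr1 => /complexI e1.
have : y * x ^+ k <= y by rewrite ler_piMr // exprn_ile1 // ltW.
by rewrite -e1 leNgt y1.
Qed.

(** For 0 <= t <= y < 1 one has 1/(1-t) <= 1 + t/(1-y), which reduces the inverse product to
    [prod_1D_le]. *)
Lemma norm_poch_inv_le n : y < 1 -> `|(poch a p n)^-1| <= (expR (y / (1 - y) / (1 - x)))%:C.
Proof.
move=> y1; rewrite /poch -prodfV normr_prod.
have xk k : 0 <= x ^+ k <= 1 by rewrite exprn_ge0 //= exprn_ile1 // ltW.
have y10 : 0 < 1 - y by rewrite subr_gt0.
apply: (@le_trans _ _ (\prod_(k < n) (1 + y / (1 - y) * x ^+ k))%:C); last first.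
  rewrite lecR; apply: (prod_1D_le (f := fun k => y / (1 - y) * x ^+ k)) => [k|//|]; last by rewrite divr_ge0 ?(ltW y10).
  by rewrite mulr_ge0 ?divr_ge0 ?exprn_ge0 // ltW.
rewrite rmorph_prod /=; apply: ler_prod => k _; rewrite normr_ge0 /=.
have /andP[k0 k1] := xk k; set t := y * x ^+ k.
have tE : `|a * p ^+ k| = t%:C := norm_apk k.
have ty : t <= y by rewrite /t ler_piMr.
have t0 : 0 <= t by rewrite mulr_ge0.
have t1 : 0 < 1 - t by lra.
rewrite normfV; apply: (@le_trans _ _ ((1 - t)^-1)%:C).
  rewrite fmorphV /= lef_pV2 ?posrE; last by rewrite ltcR.
    rewrite rmorphB rmorph1 /= -tE -[X in X - _](@normr1 R[i]).
    exact: lerB_dist.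
  by rewrite normr_gt0 poch_factor_neq0.
rewrite lecR -[leLHS]mul1r ler_pdivrMr // mulrAC -/t.
have -> : (1 + t / (1 - y)) * (1 - t) = 1 + t * (y - t) / (1 - y) by field; lra.
by rewrite lerDl divr_ge0 ?mulr_ge0 ?subr_ge0 // ltW.
Qed.

(** The products telescope: consecutive ones differ by -(a; p)_k a p^k, which is geometrically
    bounded. *)
Lemma poch_cvg : (poch a p : nat -> R[i]^o) @ \oo --> (qpoch_inf a p : R[i]^o).
Proof.
suff [l al] : exists l : R[i], (poch a p : nat -> R[i]^o) @ \oo --> (l : R[i]^o).
  have : cvgn (poch a p : nat -> R[i]^o) by exact: cvgP al.
  exact.
pose C := expR (y / (1 - x)) * y.
have C0 : 0 <= C by rewrite mulr_ge0 ?expR_ge0.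
have [|S HS] := @dominated_has_sum R nat (fun k => - (poch a p k * (a * p ^+ k))) _
  (geometric_bounded x0 x1 C0).
  move=> k; rewrite normrN normrM norm_apk /C -mulrA [leRHS]rmorphM /= ler_wpM2r //.
    by rewrite -norm_apk.
  exact: norm_poch_le.
exists (1 + S).
rewrite (_ : poch a p = fun n => 1 + \sum_(k <- iota 0 n) - (poch a p k * (a * p ^+ k))).
  apply: cvgD; first exact: cvg_cst.
  apply: (has_sum_seq HS) => [M|t]; first exact: iota_uniq.
  by near=> M; rewrite mem_iota /=; near: M; exact: nbhs_infty_gt.
apply/funext => n; elim: n => [|n IH]; first by rewrite poch0 big_nil addr0.
by rewrite pochS -addn1 iotaD big_cat /= big_seq1 addrA -IH; ring.
Unshelve. all: by end_near. Qed.

(** The inverses of the partial products are uniformly bounded, so the partial products stay away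
    from 0. *)
Lemma qpoch_inf_neq0 : y < 1 -> qpoch_inf a p != 0.
Proof.
move=> y1; apply/eqP => l0; have := poch_cvg; rewrite l0.
set e := expR (y / (1 - y) / (1 - x)) => /cvgrPdistC_lt.
have e0 : 0 < e^-1 by rewrite invr_gt0 expR_gt0.
have e0C : 0 < (e^-1)%:C :> R[i] by rewrite ltcR.
move=> /(_ _ e0C)[N _ /(_ N (leqnn _))] /=; rewrite subr0.
have := norm_poch_inv_le N y1; rewrite -/e normfV => He.
have P0 : poch a p N != 0 by apply/prodf_neq0 => k _; exact: poch_factor_neq0.
have eC : 0 < e%:C :> R[i] by rewrite ltcR expR_gt0.
have : (e%:C)^-1 <= `|poch a p N|.
  by rewrite -[leRHS]invrK lef_pV2 ?posrE ?invr_gt0 ?normr_gt0.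
by rewrite -fmorphV => /le_lt_trans H /H; rewrite ltxx.
Qed.

End PochhammerBounds.

Section ComplexSequences.
Local Open Scope classical_set_scope.
Variable R : realType.
Implicit Types (u v : nat -> R[i]) (l k : R[i]).

(* Keeps the topology of [R[i]^o] out of the way of unification. *)
Variant seq_cvg u l : Prop :=
  SeqCvg of (u : nat -> R[i]^o) @ \oo --> (l : R[i]^o).

Lemma seq_cvgP u l : seq_cvg u l -> (u : nat -> R[i]^o) @ \oo --> (l : R[i]^o).
Proof. by case. Qed.

Lemma seq_cvg_cst l : seq_cvg (fun=> l) l.
Proof. by split; exact: cvg_cst. Qed.

Lemma seq_cvgD u v l k : seq_cvg u l -> seq_cvg v k -> seq_cvg (fun n => u n + v n) (l + k).
Proof. by move=> [ul] [vk]; split; exact: (@cvgD R[i] R[i]^o nat \oo _ u v l k ul vk). Qed.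

Lemma seq_cvgB u v l k : seq_cvg u l -> seq_cvg v k -> seq_cvg (fun n => u n - v n) (l - k).
Proof. by move=> [ul] [vk]; split; exact: (@cvgB R[i] R[i]^o nat \oo _ u v l k ul vk). Qed.

Lemma seq_cvgM u v l k : seq_cvg u l -> seq_cvg v k -> seq_cvg (fun n => u n * v n) (l * k).
Proof. by move=> [ul] [vk]; split; exact: (@cvgM R[i] nat \oo _ u v l k ul vk). Qed.

Lemma seq_cvgV u l : l != 0 -> seq_cvg u l -> seq_cvg (fun n => (u n)^-1) l^-1.
Proof. by move=> l0 [ul]; split; exact: (@cvgV R[i]). Qed.

Lemma seq_cvg_unique u l k : seq_cvg u l -> seq_cvg u k -> l = k.
Proof. by move=> [ul] [uk]; exact: (cvg_unique (@norm_hausdorff _ R[i]^o) ul uk). Qed.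

Lemma seq_cvg_near u v l N : (forall n, (N <= n)%N -> u n = v n) -> seq_cvg u l -> seq_cvg v l.
Proof.
move=> uv [ul]; split; apply: cvg_trans ul; apply: near_eq_cvg.
by near=> n; apply: uv; near: n; exact: nbhs_infty_ge.
Unshelve. all: by end_near. Qed.

Lemma seq_cvg_eq u v l : u =1 v -> seq_cvg u l -> seq_cvg v l.
Proof. by move=> uv; apply: (@seq_cvg_near _ _ _ 0%N) => n _; exact: uv. Qed.

Lemma seq_cvg_comp u l (g : nat -> nat) : (forall N, exists M, forall n, (M <= n)%N -> (N <= g n)%N) ->
  seq_cvg u l -> seq_cvg (fun n => u (g n)) l.
Proof.
move=> gN [ul]; split; apply: (@cvg_comp _ _ _ g (u : nat -> R[i]^o) \oo \oo) ul.
move=> A [N _ NA]; have [M HM] := gN N; exists M => // n /= Mn; apply: NA; exact: HM.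
Qed.

End ComplexSequences.

(** * The summand of the partial Nahm sums *)

Section ComplexExponential.
Variable R : realType.
Implicit Types (z w tau : R[i]) (x y : rat).

Lemma cexpD z w : cexp (z + w) = cexp z * cexp w.
Proof.
case: z w => a b [c d]; rewrite /cexp /= expRD cosD sinD.
by apply/eqP; rewrite eq_complex /=; apply/andP; split; apply/eqP; ring.
Qed.

Lemma e2piD z w : e2pi (z + w) = e2pi z * e2pi w.
Proof. by rewrite /e2pi mulrDr cexpD. Qed.

Lemma e2pi0 : e2pi (0 : R[i]) = 1.
Proof.
rewrite /e2pi mulr0 /cexp -[0]/(0 +i* 0) /= expR0 cos0 sin0.
by rewrite rmorph1 mul1r.
Qed.

Lemma e2pi_neq0 z : e2pi z != 0.
Proof.
by apply: contra_neq (oner_neq0 R[i]) => e; rewrite -e2pi0 -(subrr z) e2piD e mul0r subrr.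
Qed.

Lemma e2pi_half : e2pi (2^-1 : R[i]) = - 1.
Proof.
rewrite /e2pi; have -> : (2 * pi) *i * (2^-1 : R[i]) = pi *i.
  have -> : (2^-1 : R[i]) = (2^-1)%:C by rewrite fmorphV /= rmorph_nat.
  by apply/eqP; rewrite eq_complex /=; apply/andP; split; apply/eqP; field.
rewrite /cexp /= expR0 cospi sinpi; apply/eqP; rewrite eq_complex /=.
by apply/andP; split; apply/eqP; ring.
Qed.

Lemma norm_e2pi z : `|e2pi z| = (expR (- (2 * pi * complex.Im z)))%:C.
Proof.
case: z => a b; rewrite /e2pi /cexp /= normc_def /=.
rewrite !(mul0r, sub0r, add0r, addr0, subr0).
set t := expR _; set u := _ * a.
have -> : (t * cos u) ^+ 2 + (t * sin u) ^+ 2 = t ^+ 2.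
  by rewrite !exprMn -mulrDr cos2Dsin2 mulr1.
by rewrite sqrtr_sqr ger0_norm // expR_ge0.
Qed.

Lemma qpowD x y tau : qpow (x + y) tau = qpow x tau * qpow y tau.
Proof. by rewrite /qpow rmorphD /= mulrDl e2piD. Qed.

Lemma qpow_nat n tau : qpow n%:R tau = qpow 1 tau ^+ n.
Proof.
elim: n => [|n IH]; first by rewrite /qpow rmorph0 mul0r e2pi0.
by rewrite -natr1 qpowD IH exprSr.
Qed.

Lemma qpow_half x tau : qpow x (tau + 2^-1) = qpow x tau * e2pi (ratr x / 2).
Proof. by rewrite /qpow mulrDr e2piD. Qed.

Lemma qpow1_half tau : qpow 1 (tau + 2^-1) = - qpow 1 tau.
Proof. by rewrite qpow_half rmorph1 div1r e2pi_half mulrN1. Qed.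

Lemma qpow_neq0 x tau : qpow x tau != 0. Proof. exact: e2pi_neq0. Qed.

Lemma norm_qpow1_lt1 tau : 0 < complex.Im tau -> exists2 x : R, `|qpow 1 tau| = x%:C & x < 1.
Proof.
move=> t0; exists (expR (- (2 * pi * complex.Im tau))).
  by rewrite /qpow rmorph1 mul1r norm_e2pi.
by rewrite expR_lt1 oppr_lt0 !mulr_gt0 // pi_gt0.
Qed.

End ComplexExponential.

(** * The exponent of the Nahm summand in terms of the suffix sums N_k *)

Section SuffixSums.

Fixpoint sqsum (l : seq nat) : nat :=
  if l is x :: l' then (sumn l ^ 2 + sqsum l')%N else 0%N.

Fixpoint linsum (lam : nat -> nat) (l : seq nat) : nat :=
  if l is x :: l' then (lam (size l) * sumn l + linsum lam l')%N else 0%N.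

Lemma sumn_nth l : sumn l = (\sum_(i < size l) nth 0 l i)%N.
Proof. by rewrite sumnE (big_nth 0%N) big_mkord. Qed.

(** The product of entries i and j occurs in the squares of those suffix sums that start at or
    before min(i, j). *)
Lemma sqsumE l :
  sqsum l = (\sum_(i < size l) \sum_(j < size l) (minn i j).+1 * nth 0 l i * nth 0 l j)%N.
Proof.
elim: l => [|x l IH]; first by rewrite big_ord0.
rewrite [sqsum _]/= [size _]/= big_ord_recl.
have -> : (\sum_(j < (size l).+1) (minn (@ord0 (size l)) j).+1
      * nth 0 (x :: l) (@ord0 (size l)) * nth 0 (x :: l) j
    = x * (x + sumn l))%N.
  under eq_bigr do rewrite min0n mul1n.
  by rewrite -big_distrr /= big_ord_recl /= [in RHS]sumn_nth.
under eq_bigr => i _.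
  have -> : (\sum_(j < (size l).+1) (minn (lift ord0 i) j).+1
        * nth 0 (x :: l) (lift ord0 i) * nth 0 (x :: l) j
     = nth 0 l i * x
       + (\sum_(j < size l) (minn i j).+1 * nth 0 l i * nth 0 l j + nth 0 l i * sumn l))%N.
    rewrite big_ord_recl /= minn0 mul1n sumn_nth big_distrr /= -big_split /=.
    congr (_ + _)%N; apply: eq_bigr => j _; rewrite /bump /= !add1n minnSS.
    by rewrite [(_.+2 * _)%N]mulSn mulnDl addnC.
over.
rewrite !big_split /= -IH -!big_distrl /= -sumn_nth; lia.
Qed.

Lemma linsumE lam l :
  linsum lam l = (\sum_(t < size l) (\sum_(u < t.+1) lam (size l - u)) * nth 0 l t)%N.
Proof.
elim: l => [|x l IH]; first by rewrite big_ord0.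
rewrite [linsum _ _]/= [size _]/= big_ord_recl /= big_ord1 subn0 IH.
under [X in _ = (_ + X)%N]eq_bigr => t _.
  rewrite /bump /= add1n big_ord_recl /= subn0.
  under eq_bigr do rewrite /bump /= add1n subSS.
  rewrite mulnDl.
over.
by rewrite big_split /= -big_distrr /= -sumn_nth mulnDr addnA.
Qed.

(** The coefficient of n_(t+2) in the sum of N_k over i < k < r, that is, an entry of b_i. The last
    entry stops at r-i-1 because N_r carries no linear term. *)
Lemma lam_mid_count s i t : (1 <= i <= s.+1)%N -> (t <= s)%N ->
  (\sum_(u < t.+1) lam_mid (s.+2 - i) (s.+1 - u))%N =
  (if t == s then s.+1 - i else t.+2 - i)%N.
Proof.
move=> /andP[i1 is1]; elim: t => [|t IH] ts.
  rewrite big_ord1 subn0 /lam_mid; case: eqP => ?; lia.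
rewrite big_ord_recr IH ?(ltnW ts) //= /lam_mid.
have -> : (t == s) = false by lia.
by case: eqP => ?; lia.
Qed.

End SuffixSums.

Section ChainProduct.
Variables (K : fieldType) (p : K).

Lemma chain_prod (beta : nat -> K) lam l : l != [::] ->
  p ^+ (sumn l ^ 2 + lam (size l) * sumn l) * chain p beta lam l =
  p ^+ (sqsum l + linsum lam l) *
  \prod_(i < size l) (if i.+1 == size l then beta (nth 0%N l i) else rp p (nth 0%N l i)).
Proof.
elim: l => [//|x [_ _|y l IH _]]; first by rewrite /= big_ord1 /= !addn0.
have {}IH := IH isT; set l' := y :: l in IH *.
have -> : chain p beta lam (x :: l') =
    rp p x * (p ^+ (sumn l' ^ 2 + lam (size l') * sumn l') * chain p beta lam l').
  by rewrite mulrA.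
rewrite IH [size (x :: l')]/= big_ord_recl [X in _ = _ * (X * _)]/=.
rewrite (_ : sqsum (x :: l') + linsum lam (x :: l') = (sumn (x :: l') ^ 2
    + lam (size l').+1 * sumn (x :: l')) + (sqsum l' + linsum lam l'))%N; last first.
  by rewrite /=; lia.
by rewrite [in RHS]exprD; ring.
Qed.

End ChainProduct.

Section Exponent.

(** The symmetric integral matrix B^vee diag(d^vee) for r = s+2, with indices from 0; doubling d^vee
    cancels the factor 1/2 of the exponent. *)
Definition form_entry (s i j : nat) : nat :=
  match i, j with
  | 0, 0 => 1
  | 0, j'.+1 => j' == s
  | i'.+1, 0 => i' == s
  | i'.+1, j'.+1 => 2 * (minn i' j').+1 + ((i' == s) && (j' == s))
  end.

Lemma B_vee_entryE s (i j : 'I_s.+2) :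
  B_vee_entry s.+2 i.+1 j.+1 * (d_vee j)%:R = (form_entry s i j)%:R.
Proof.
have := ltn_ord i; have := ltn_ord j; rewrite /B_vee_entry /d_vee !eqSS.
case: i j => [[|i] /= hi] [[|j] /= hj] _ _ //=; rewrite ?eqSS.
- by case: (j =P s) => js; rewrite ?mul0r // mulVf.
- by case: (i =P s) => is_; rewrite ?mul0r ?mulr1.
have js' : (j.+2 < s.+2)%N = (j != s) by lia.
have is' : (i.+2 < s.+2)%N = (i != s) by lia.
rewrite js' is'; case: (j =P s) => js /=; case: (i =P s) => is_ /=.
- have -> : minn i j = s by lia.
  by rewrite natrD natrM -!natr1; field.
- have -> : minn i j = i by lia.
  by rewrite addn0 natrM -!natr1; ring.
- by rewrite addn0 mulr1 !minnSS natrM -!natr1; ring.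
- by rewrite addn0 mulr1 !minnSS natrM -!natr1; ring.
Qed.

Lemma sum_delta_max s (f : nat -> nat) :
  (\sum_(j < s.+1) (val j == s) * f j = f s)%N.
Proof.
rewrite big_ord_recr /= eqxx mul1n big1 // => j _.
by rewrite (_ : (val j == s) = false) //; apply/eqP; have := ltn_ord j; rewrite /=; lia.
Qed.

Lemma form_sum s (a0 : nat) (b : nat -> nat) :
  let a i := if i is i'.+1 then b i' else a0 in
  (\sum_(i < s.+2) \sum_(j < s.+2) form_entry s i j * a i * a j =
  (a0 + b s) ^ 2 + 2 * \sum_(i < s.+1) \sum_(j < s.+1) (minn i j).+1 * b i * b j)%N.
Proof.
set a := fun i => _; cbv zeta; rewrite big_ord_recl.
have -> : (\sum_(j < s.+2) form_entry s (@ord0 s.+1) j * a (@ord0 s.+1) * a j = a0 * a0 + a0 * b s)%N.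
  rewrite big_ord_recl /= mul1n; congr (_ + _)%N.
  rewrite -(sum_delta_max s (fun j => (a0 * b j)%N)).
  by apply: eq_bigr => j _; rewrite /bump /= mulnA.
under eq_bigr => i _.
  have -> : (\sum_(j < s.+2) form_entry s (lift ord0 i) j * a (lift ord0 i) * a j
    = (val i == s) * (b i * a0)
      + (2 * (\sum_(j < s.+1) (minn i j).+1 * b i * b j) + (val i == s) * (b i * b s)))%N.
    rewrite big_ord_recl /= /bump /= add0n mulnA; congr (_ + _)%N.
    rewrite -(sum_delta_max s (fun j => (b i * b j)%N)) !big_distrr -big_split /=.
    by apply: eq_bigr => j _; rewrite add0n -mulnb; lia.
over.
rewrite !big_split /= sum_nat_const muln0.
rewrite (sum_delta_max s (fun i => (b i * a0)%N)) (sum_delta_max s (fun i => (b i * b s)%N)).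
lia.
Qed.

Lemma b_vec_entry0 s k : b_vec_entry s 0 k.+1 = (if k is k'.+1 then k'.+1 else 1)%:R.
Proof.
rewrite /b_vec_entry /=; case: k => [|k]; first by [].
by rewrite -!natr1; ring.
Qed.

Lemma b_vec_entryS s i k : (1 <= i <= s.+1)%N ->
  b_vec_entry s.+2 i k.+1 = (if k is k'.+1 then if k'.+2 < s.+2 then k'.+2 - i else s.+1 - i else 0)%N%:R.
Proof.
move=> /andP[i1 is1]; rewrite /b_vec_entry (_ : (i == 0%N) = false); last lia.
case: k => [|k] /=.
  by rewrite max_r // subr_le0 ler1n.
case: ifP => ks.
  have [ik|ki] := leqP i k.+2; first by rewrite natrB // max_l // subr_ge0 ler_nat.
  rewrite max_r ?subr_le0 ?ler_nat ?(ltnW ki) //.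
  by rewrite (_ : (k.+2 - i = 0)%N) //; lia.
by rewrite natrB // -!natr1; ring.
Qed.

End Exponent.

Section NahmTerm.
Variables (R : realType) (tau : R[i]) (s i : nat).
Hypothesis is1 : (i <= s.+1)%N.
Let q := qpow 1 tau.

(** The constant 1 reflects that b_0 pairs with n to n_1 + N_2 + ... + N_r. *)
Definition lam_of : nat -> nat := if i == 0%N then fun=> 1%N else lam_mid (s.+2 - i).

Variable n : {ffun 'I_s.+2 -> nat}.
Let l := [seq n (lift ord0 k) | k <- enum 'I_s.+1].

Let size_l : size l = s.+1. Proof. by rewrite size_map size_enum_ord. Qed.

Let nth_l k (ks : (k < s.+1)%N) : nth 0%N l k = n (lift ord0 (Ordinal ks)).
Proof.
rewrite (nth_map ord0) ?size_enum_ord //; congr (n (lift _ _)).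
by apply: val_inj; rewrite /= nth_enum_ord.
Qed.

Let a k := if k is k'.+1 then nth 0%N l k' else n ord0.

Let aE (k : 'I_s.+2) : n k = a k.
Proof.
case: (unliftP ord0 k) => [k'|] -> //.
by rewrite /= (nth_l (ltn_ord k')); congr (fun_of_fin n (lift _ _)); apply: val_inj.
Qed.

Lemma quadratic_part :
  2^-1 * (((\col_k (n k)%:R : 'cV[rat]_s.+2)^T *m B_vee s.+2 *m
     diag_mx (\row_k (2 * d_vee k)%:R) *m (\col_k (n k)%:R)) 0 0) =
  ((n ord0 + nth 0%N l s) ^ 2 + 2 * sqsum l)%:R.
Proof.
rewrite sqsumE size_l -(form_sum s (n ord0) (nth 0%N l)) -/a.
rewrite mxE mulr_sumr exchange_big natr_sum /=; apply: eq_bigr => j _.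
rewrite mul_mx_diag !mxE -!mulrA mulr_suml mulr_sumr natr_sum; apply: eq_bigr => k _.
by rewrite !mxE !natrM -B_vee_entryE !aE; field.
Qed.

Lemma linear_part :
  ((\col_k (n k)%:R : 'cV[rat]_s.+2)^T *m (2 *: b_vec s.+2 i)) 0 0 =
  (2 * ((i == 0%N) * n ord0 + linsum lam_of l))%:R.
Proof.
rewrite mxE natrM big_ord_recl; under eq_bigr do rewrite !mxE; rewrite !mxE /=.
rewrite linsumE size_l natrD natrM mulrDr natr_sum; congr (_ + _).
  case: (i =P 0%N) => [->|i0] /=; first by rewrite b_vec_entry0; ring.
  by rewrite b_vec_entryS; [rewrite !mulr0 mul0r mulr0 | lia].
rewrite mulr_sumr; apply: eq_bigr => k _.
rewrite (nth_l (ltn_ord k)) (_ : Ordinal _ = k); last exact: val_inj.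
rewrite /lam_of natrM /bump /= add1n; case: (i =P 0%N) => [->|i0].
  by rewrite b_vec_entry0 sum_nat_const card_ord muln1; ring.
rewrite b_vec_entryS; last lia.
rewrite lam_mid_count; [|lia|by rewrite -ltnS].
have -> : (k.+2 < s.+2)%N = (val k != s) by have := ltn_ord k; rewrite /=; lia.
by case: eqP => ks /=; ring.
Qed.

Lemma nahm_term_body :
  (-1) ^+ n ord_max * nahm_term (B_vee s.+2) (2 *: b_vec s.+2 i) (2 * c_const s.+2 i)
    (fun k => (2 * d_vee k)%N) tau n =
  qpow (2 * c_const s.+2 i) tau * body q (i == 0%N) lam_of (n ord0) l.
Proof.
have lne : l != [::] by rewrite -size_eq0 size_l.
have last_l : last 0%N l = n ord_max.
  by rewrite (last_nth 0%N) size_l /= (nth_l (ltnSn s)); congr (fun_of_fin n _); apply: val_inj.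
pose E := ((n ord0 + nth 0%N l s) ^ 2 + 2 * sqsum l
  + 2 * ((i == 0%N) * n ord0 + linsum lam_of l))%N.
rewrite [nahm_term _ _ _ _ _ _](_ : _ =
  qpow (E%:R + 2 * c_const s.+2 i) tau
  / \prod_(k < s.+2) poch (q ^+ (2 * d_vee k)) (q ^+ (2 * d_vee k)) (n k)); last first.
  rewrite natrD -quadratic_part -linear_part; congr (_ / _).
  by apply: eq_bigr => k _; rewrite -qpow_nat.
rewrite addrC qpowD qpow_nat -/q mulrCA -mulrA; congr (_ * _).
have last_s : nth 0%N l s = n ord_max by rewrite -last_l (last_nth 0%N) size_l.
rewrite /body -mulrA chain_prod // last_l size_l.
set P := \prod_(k < s.+1) _.
have -> : P = (-1) ^+ n ord_max * (\prod_(k < s.+1)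
    poch (q ^+ (2 * d_vee (lift ord0 k))) (q ^+ (2 * d_vee (lift ord0 k)))
      (n (lift ord0 k)))^-1.
  rewrite -prodfV /P big_ord_recr [in RHS]big_ord_recr /= eqxx last_s.
  rewrite /d_vee /= /bump /= !add1n eqxx -exprM !mulrA [in RHS]mulrC mulrA.
  rewrite (_ : lift ord0 ord_max = ord_max); last exact: val_inj.
  rewrite -[LHS]mulrA [LHS]mulrC [_ / _]mulrC; congr (_ * _).
  apply: eq_bigr => k _; have := ltn_ord k => ks.
  have ksF : (k == s :> nat) = false by lia.
  have ks1 : (k < s.+1)%N by lia.
  rewrite !eqSS ksF muln1 (nth_l ks1) /rp /=.
  by congr (poch _ _ (fun_of_fin n (lift _ _)))^-1; apply: val_inj.
rewrite big_ord_recl invfM /rp (_ : (d_vee ord0 = 1)%N) //.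
rewrite muln1 [RHS](_ : _ = (q ^+ ((n ord0 + n ord_max) ^ 2 + 2 * (i == 0%N) * n ord0)
   * (q ^+ 2) ^+ (sqsum l + linsum lam_of l)) * ((poch (q ^+ 2) (q ^+ 2) (n ord0))^-1 *
   ((-1) ^+ n ord_max * (\prod_(k < s.+1)
     poch (q ^+ (2 * d_vee (lift ord0 k))) (q ^+ (2 * d_vee (lift ord0 k)))
       (n (lift ord0 k)))^-1))).
  rewrite -exprM -exprD (_ : (_ ^ 2 + _ + 2 * _ = E)%N); first by ring.
  by rewrite /E last_s; lia.
by ring.
Qed.

End NahmTerm.

(** * Limits of the finite identities *)

Section PochhammerIdentities.
Local Open Scope classical_set_scope.
Variable K : comPzRingType.
Implicit Types (a t : K).

Lemma poch_double a t n :
  poch a t n.*2 = poch a (t ^+ 2) n * poch (a * t) (t ^+ 2) n.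
Proof.
elim: n => [|n IH]; first by rewrite !poch0 mul1r.
rewrite doubleS !pochS IH [t ^+ _.*2.+1]exprSr -!exprM mul2n; ring.
Qed.

Lemma poch_mulN a t n : poch a t n * poch (- a) t n = poch (a ^+ 2) (t ^+ 2) n.
Proof.
elim: n => [|n IH]; first by rewrite !poch0 mul1r.
rewrite !pochS -IH -exprM mulnC exprM; ring.
Qed.

End PochhammerIdentities.

Section Limits.
Local Open Scope classical_set_scope.
Variables (R : realType).

Definition in_disc (p : R[i]) : Prop := exists2 x : R, `|p| = x%:C & x < 1.

Lemma normE (a : R[i]) : exists y : R, `|a| = y%:C.
Proof. by exists (ComplexField.Normc.normc a). Qed.

Lemma in_disc_ge0 (p : R[i]) x : `|p| = x%:C -> 0 <= x.
Proof. by move=> px; rewrite -ler0c -px. Qed.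

Lemma in_disc_exp (p : R[i]) n : in_disc p -> in_disc (p ^+ n.+1).
Proof.
move=> [x px x1]; exists (x ^+ n.+1); first by rewrite normrX px rmorphXn.
by rewrite exprn_ilt1 // (in_disc_ge0 px).
Qed.

Lemma in_discN (p : R[i]) : in_disc p -> in_disc (- p).
Proof. by move=> [x px x1]; exists x; rewrite ?normrN. Qed.

Lemma in_disc_neq1 (p : R[i]) n : in_disc p -> p ^+ n.+1 != 1.
Proof.
move=> /(in_disc_exp n)[x px x1]; apply/eqP => e; move: px.
by rewrite e normr1 => /complexI e1; rewrite -e1 ltxx in x1.
Qed.

Lemma poch_lim (a p : R[i]) : in_disc p -> seq_cvg (poch a p) (qpoch_inf a p).
Proof. by move=> [x px x1]; have [y ay] := normE a; split; exact: (poch_cvg px x1 ay). Qed.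

Lemma qpoch_inf_neq0_disc (a p : R[i]) : in_disc p -> in_disc a -> qpoch_inf a p != 0.
Proof. by move=> [x px x1] [y ay y1]; exact: (qpoch_inf_neq0 px x1 ay). Qed.

Lemma poch_bounded (a p : R[i]) : in_disc p ->
  exists2 C : R, 0 <= C & forall n, `|poch a p n| <= C%:C.
Proof.
move=> [x px x1]; have [y ay] := normE a.
by exists (expR (y / (1 - x))); [exact: expR_ge0|move=> n; exact: norm_poch_le].
Qed.

Lemma rp_bounded (p : R[i]) : in_disc p ->
  exists2 C : R, 0 <= C & forall m, `|rp p m| <= C%:C.
Proof.
move=> [x px x1]; exists (expR (x / (1 - x) / (1 - x))); first exact: expR_ge0.
case=> n; first exact: (norm_poch_inv_le px x1 px).
by rewrite rp_lt0 // normr0 ler0c expR_ge0.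
Qed.

Lemma rp_lim (p : R[i]) (c : int) : in_disc p ->
  seq_cvg (fun M => rp p (M%:Z + c)) (qpoch_inf p p)^-1.
Proof.
move=> dp; apply: (@seq_cvg_near R (fun M => (poch p p (absz (M%:Z + c)))^-1) (fun M => rp p (M%:Z + c)) _ (absz c)).
  move=> M Mc; have: 0 <= M%:Z + c by lia.
  by case: (M%:Z + c).
apply: seq_cvgV; first exact: qpoch_inf_neq0_disc.
apply: (@seq_cvg_comp _ _ _ (fun M => absz (M%:Z + c))); last exact: poch_lim.
by move=> N; exists (N + absz c)%N => M; lia.
Qed.

Lemma qpochs_inf3 (a b c p : R[i]) :
  qpochs_inf [:: a; b; c] p = qpoch_inf a p * qpoch_inf b p * qpoch_inf c p.
Proof. by rewrite /qpochs_inf !big_cons big_nil mulr1 mulrA. Qed.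

(** Combine (q; q^2)(-q; q^2) = (q^2; q^4) with the splittings of (q; q^2) and (q^2; q^2) into
    factors of even and odd index. *)
Lemma infinite_product_identity (q : R[i]) : in_disc q ->
  qpoch_inf (- q) (q ^+ 2) / qpoch_inf (q ^+ 2) (q ^+ 2) =
  (qpochs_inf [:: q; q ^+ 3; q ^+ 4] (q ^+ 4))^-1.
Proof.
move=> dq; have d2 := in_disc_exp 1 dq; have d3 := in_disc_exp 2 dq; have d4 := in_disc_exp 3 dq.
have double : forall N, exists M, forall n, (M <= n)%N -> (N <= n.*2)%N.
  by move=> N; exists N => n; lia.
have e1 : qpoch_inf q (q ^+ 2) = qpoch_inf q (q ^+ 4) * qpoch_inf (q ^+ 3) (q ^+ 4).
  apply: (@seq_cvg_unique _ (fun n => poch q (q ^+ 2) n.*2)).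
    exact: (seq_cvg_comp double (poch_lim _ d2)).
  apply: (@seq_cvg_eq _ (fun n => poch q (q ^+ 4) n * poch (q ^+ 3) (q ^+ 4) n)).
    by move=> n; rewrite poch_double -exprM -exprS.
  by apply: seq_cvgM; exact: poch_lim.
have e2 : qpoch_inf (q ^+ 2) (q ^+ 2) = qpoch_inf (q ^+ 2) (q ^+ 4) * qpoch_inf (q ^+ 4) (q ^+ 4).
  apply: (@seq_cvg_unique _ (fun n => poch (q ^+ 2) (q ^+ 2) n.*2)).
    exact: (seq_cvg_comp double (poch_lim _ d2)).
  apply: (@seq_cvg_eq _ (fun n => poch (q ^+ 2) (q ^+ 4) n * poch (q ^+ 4) (q ^+ 4) n)).
    by move=> n; rewrite poch_double -exprM -exprD.
  by apply: seq_cvgM; exact: poch_lim.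
have e3 : qpoch_inf q (q ^+ 2) * qpoch_inf (- q) (q ^+ 2) = qpoch_inf (q ^+ 2) (q ^+ 4).
  apply: (@seq_cvg_unique _ (poch (q ^+ 2) (q ^+ 4))); last exact: poch_lim.
  apply: (@seq_cvg_eq _ (fun n => poch q (q ^+ 2) n * poch (- q) (q ^+ 2) n)).
    by move=> n; rewrite poch_mulN -exprM.
  by apply: seq_cvgM; exact: poch_lim.
rewrite qpochs_inf3 [qpoch_inf (q ^+ 2) (q ^+ 2)]e2 -[qpoch_inf (q ^+ 2) (q ^+ 4)]e3
  [qpoch_inf q (q ^+ 2)]e1.
have := qpoch_inf_neq0_disc d2 (in_discN dq).
have := qpoch_inf_neq0_disc d4 dq; have := qpoch_inf_neq0_disc d4 d3; have := qpoch_inf_neq0_disc d4 d4.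
move: (qpoch_inf _ _) (qpoch_inf _ _) (qpoch_inf _ _) (qpoch_inf _ _) => a b c d a0 b0 c0 d0.
by field; rewrite a0 b0 c0 d0.
Qed.

(** For k < 0 the right side is (Q-m)(-k) + Q([tri k] + k), a sum of nonnegative terms of which the
    first is at least |k|. *)
Lemma theta_term_exp_ge (m Q : nat) k : (0 < m < Q)%N ->
  (`|k|%N%:Z <= m%:Z * k + Q%:Z * tri k).
Proof.
move=> /andP[m0 mQ]; have tk := triE k.
have [k0|k0] := leP 0 k.
  have t0 : 0 <= tri k.
    by rewrite -(pmulr_lge0 _ (isT : 0 < 2 :> int)) tk; case: (k) k0 => [[|n]|] // _; rewrite mulr_ge0 //; lia.
  have : 0 <= (m%:Z - 1) * k by rewrite mulr_ge0 //; lia.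
  have : 0 <= Q%:Z * tri k by rewrite mulr_ge0.
  by rewrite mulrBl; lia.
have kk : 0 <= (- k) * (- k - 1) by rewrite mulr_ge0 //; lia.
have t0 : 0 <= tri k + k.
  by rewrite -(pmulr_lge0 _ (isT : 0 < 2 :> int)) mulrDl tk; lia.
have : 0 <= (Q%:Z - m%:Z - 1) * (- k) by rewrite mulr_ge0 //; lia.
have : 0 <= Q%:Z * (tri k + k) by rewrite mulr_ge0.
rewrite !mulrBl !mulrDr !mulrN; lia.
Qed.

Lemma theta_term_bound (q : R[i]) x (m Q : nat) k : `|q| = x%:C -> x < 1 -> q != 0 ->
  (0 < m < Q)%N -> `|theta_term (q ^+ m) (q ^+ Q) k| <= (x ^+ `|k|%N)%:C.
Proof.
move=> qx x1 q0 mQ; rewrite coef_theta // /coef.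
have := theta_term_exp_ge k mQ; case: (_ + _) => // h kh.
rewrite normrM -exprnP normrX qx.
have -> : `|(-1) ^ k : R[i]| = 1.
  by case: (k) => n; rewrite ?NegzE -?exprnN ?normfV -?exprnP normrX normrN1 expr1n ?invr1.
rewrite mul1r -rmorphXn lecR ler_wiXn2l ?(ltW x1) ?(in_disc_ge0 qx) //; lia.
Qed.

(** The kernel times (p; p)_M^2 tends to 1 for each k, and so does its analogue in base P = q^Q. By
    [tannery] the kernel can therefore be exchanged for [kern P 0], where [finite_triple_product]
    gives the sum in closed form. *)
Lemma theta_limit (q p : R[i]) (m Q a : nat) : in_disc q -> q != 0 -> in_disc p -> p != 0 ->
  (0 < m < Q)%N ->
  seq_cvg (fun M => poch p p M ^+ 2 *
      bsum M.+2 (fun k => theta_term (q ^+ m) (q ^+ Q) k * kern p a M%:Z k))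
    (qpoch_inf (q ^+ m) (q ^+ Q) * qpoch_inf (q ^+ (Q - m)) (q ^+ Q) * qpoch_inf (q ^+ Q) (q ^+ Q)).
Proof.
move=> dq q0 dp p0 mQ; set P := q ^+ Q; set z := q ^+ m.
have dP : in_disc P by case: (Q) @P mQ => [|Q'] P; [rewrite andbC|move=> _; exact: in_disc_exp].
have P0 : P != 0 by rewrite expf_neq0.
have z0 : z != 0 by rewrite expf_neq0.
have zP : P / z = q ^+ (Q - m) by rewrite /P /z expfB_cond //; lia.
have P_neq1 n := in_disc_neq1 n dP.
pose th := theta_term z P.
have JTP : seq_cvg (fun M => poch P P M ^+ 2 * bsum M.+2 (fun k => th k * kern P 0 M%:Z k))
    (qpoch_inf z P * qpoch_inf (P / z) P * qpoch_inf P P).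
  apply: (@seq_cvg_eq _ (fun M => poch P P M * poch P P M * (poch P P M.*2)^-1 *
     (poch z P M * poch (P / z) P M))).
    move=> M; rewrite -(@finite_triple_product _ P z P_neq1 P0 z0 M.+2) // expr2.
    have := poch_neq0 P_neq1 M.*2; set D := poch P P M.*2 => D0.
    by rewrite -/th; field.
  have PP0 := qpoch_inf_neq0_disc dP dP.
  rewrite [X in seq_cvg _ X](_ : _ = qpoch_inf P P * qpoch_inf P P * (qpoch_inf P P)^-1 *
    (qpoch_inf z P * qpoch_inf (P / z) P)); last by field.
  apply: seq_cvgM; last by apply: seq_cvgM; exact: poch_lim.
  apply: seq_cvgM; first by apply: seq_cvgM; exact: poch_lim.
  apply: seq_cvgV => //; apply: (@seq_cvg_comp _ (poch P P) _ double); last exact: poch_lim.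
  by move=> N; exists N => n; rewrite -addnn; lia.
have kern_lim (t : R[i]) c k : in_disc t ->
    seq_cvg (fun M => poch t t M ^+ 2 * kern t c M%:Z k) 1.
  move=> dt; have t0 := qpoch_inf_neq0_disc dt dt.
  rewrite -[X in seq_cvg _ X](_ : qpoch_inf t t * qpoch_inf t t * ((qpoch_inf t t)^-1 * (qpoch_inf t t)^-1) = 1); last by field.
  apply: seq_cvgM; first by apply: seq_cvgM; exact: poch_lim.
  apply: seq_cvgM; first exact: rp_lim.
  apply: (@seq_cvg_eq _ (fun M => rp t (M%:Z + (k + c%:Z)))); last exact: rp_lim.
  by move=> M; rewrite addrA.
have kern_bound (t : R[i]) c : in_disc t -> exists2 C : R, 0 <= C &
    forall M k, `|poch t t M ^+ 2 * kern t c M%:Z k| <= C%:C.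
  move=> dt; have [C1 C10 H1] := poch_bounded t dt; have [C2 C20 H2] := rp_bounded dt.
  exists (C1 ^+ 2 * (C2 * C2)) => [|M k]; first by rewrite !mulr_ge0 ?exprn_ge0.
  rewrite !expr2 !rmorphM /= /kern !normrM.
  by rewrite !ler_pM ?mulr_ge0.
have [C1 C10 H1] := kern_bound p a dp; have [C2 C20 H2] := kern_bound P 0%N dP.
have [x qx x1] := dq; have x0 := in_disc_ge0 qx.
pose u M k := th k * (poch p p M ^+ 2 * kern p a M%:Z k - poch P P M ^+ 2 * kern P 0 M%:Z k).
pose win M : seq int := [seq i%:Z - M.+2%:Z | i <- iota 0 (M.+2).*2.+1].
have diff0 : seq_cvg (fun M => \sum_(k <- win M) u M k) 0.
  split; apply: (tannery (geometric_int_bounded x0 x1 (addr_ge0 C10 C20))).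
  - by move=> M; rewrite map_inj_uniq ?iota_uniq // => i j; lia.
  - move=> M k; rewrite /u normrM mulrC rmorphM /=; apply: ler_pM => //.
      by rewrite rmorphD /=; apply: le_trans (ler_normB _ _) _; apply: lerD.
    exact: theta_term_bound.
  - move=> k; apply: seq_cvgP; rewrite -[X in seq_cvg _ X](_ : th k * (1 - 1) = 0); last by ring.
    apply: (@seq_cvgM _ (fun=> th k)); first exact: seq_cvg_cst.
    by apply: seq_cvgB; exact: kern_lim.
rewrite -zP -[X in seq_cvg _ X]add0r.
apply: seq_cvg_eq (seq_cvgD diff0 JTP) => M.
have -> : \sum_(k <- win M) u M k = bsum M.+2 (u M).
  by rewrite big_map /bsum -(big_mkord xpredT (fun i => u M (i%:Z - M.+2%:Z))) /index_iota subn0.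
by rewrite -!bsumZ -bsumD; apply: eq_bsum => k; rewrite /u /th; ring.
Qed.

End Limits.

(** * From weighted finite sums to the partial Nahm sums *)

Section Boxes.
Local Open Scope classical_set_scope.
Variable r : nat.

Definition box (M : nat) : seq {ffun 'I_r -> nat} :=
  [seq [ffun k => val ((g : {ffun 'I_r -> 'I_M.+1}) k)] | g <- index_enum _].

Lemma box_uniq M : uniq (box M).
Proof.
rewrite map_inj_uniq ?index_enum_uniq // => g h /ffunP gh; apply/ffunP => k.
by apply: val_inj; have := gh k; rewrite !ffunE.
Qed.

Lemma mem_box n : \forall M \near \oo, n \in box M.
Proof.
exists (\max_k n k)%N => // M /= nM.
have nM1 k : (n k < M.+1)%N by rewrite ltnS (leq_trans (leq_bigmax (F := fun k => n k) k)).
apply/mapP; exists [ffun k => Ordinal (nM1 k)]; first exact: mem_index_enum.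
by apply/ffunP => k; rewrite !ffunE.
Qed.

Lemma big_box (V : nmodType) M (F : seq nat -> V) :
  \sum_(n <- box M) F [seq n k | k <- enum 'I_r] = msum r M.+1 F.
Proof.
rewrite big_map -big_ffun_msum; apply: eq_bigr => g _.
by congr F; apply: eq_map => k; rewrite ffunE.
Qed.

End Boxes.

Section NahmSum.
Local Open Scope classical_set_scope.
Variables (R : realType) (tau : R[i]) (s i : nat).
Hypotheses (htau : 0 < complex.Im tau) (is1 : (i <= s.+1)%N).
Let q := qpow 1 tau.
Let p := q ^+ 2.
Let dq : in_disc q := norm_qpow1_lt1 htau.
Let dp : in_disc p := in_disc_exp 1 dq.
Let q0 : q != 0. Proof. exact: qpow_neq0. Qed.
Let tail (n : {ffun 'I_s.+2 -> nat}) := [seq n (lift ord0 k) | k <- enum 'I_s.+1].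
Let lam := lam_of s i.
Let g (n : {ffun 'I_s.+2 -> nat}) := body q (i == 0%N) lam (n ord0) (tail n).

Lemma sqsum_ge l : (sumn l <= sqsum l)%N.
Proof.
case: l => //= x l; apply: leq_trans (leq_addr _ _).
by case: (x + sumn l)%N => // k; rewrite expnS leq_pmulr.
Qed.

(** The exponent of q is at least n_1 + ... + n_r, since squares of natural numbers dominate the
    numbers; the other factors are bounded. *)
Lemma body_bound : exists2 C : R, 0 <= C & exists x : R, [/\ 0 <= x, x < 1 &
  forall n, `|g n| <= (C * \prod_k x ^+ n k)%:C].
Proof.
have [C1 C10 H1] := rp_bounded dp.
have [C2 C20 H2] := rp_bounded (in_disc_exp 1 dp).
have [x qx x1] := dq; have x0 := in_disc_ge0 qx.
pose C := C1 + C2; have C0 : 0 <= C by rewrite addr_ge0.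
exists (C * C ^+ s.+1); first by rewrite mulr_ge0 ?exprn_ge0.
exists x; split => // n; rewrite /g /body.
have size_l : size (tail n) = s.+1 by rewrite size_map size_enum_ord.
rewrite -mulrA chain_prod -?size_eq0 ?size_l // mulrACA -exprM -exprD !normrM.
have -> : \prod_k x ^+ n k = x ^+ (n ord0 + sumn (tail n)).
  rewrite big_ord_recl exprD; congr (_ * _).
  rewrite sumnE big_map big_enum /=; elim/big_ind2: _ => // a b c d -> ->.
  by rewrite exprD.
rewrite [leRHS]rmorphM /= mulrC; apply: ler_pM; rewrite ?mulr_ge0 //.
  rewrite rmorphM /=; apply: ler_pM => //.
    by apply: le_trans (H1 _) _; rewrite lecR lerDl.
  have -> : (C ^+ s.+1)%:C = \prod_(k < s.+1) C%:C by rewrite prodr_const card_ord rmorphXn.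
  rewrite normr_prod.
  apply: ler_prod => k _; rewrite normr_ge0 /=; case: ifP => _.
    rewrite normrM normrX normrN1 expr1n mul1r.
    by apply: le_trans (H2 (Posz _)) _; rewrite lecR lerDr.
  by apply: le_trans (H1 _) _; rewrite lecR lerDl.
rewrite normrX qx -rmorphXn lecR ler_wiXn2l ?(ltW x1) //.
have := sqsum_ge (tail n); set a := last _ _; case: (n ord0) => [|k]; nia.
Qed.

Lemma weight_bound : exists2 W : R, 0 <= W & forall M x l, `|weight q M x l| <= W%:C.
Proof.
have [C1 C10 H1] := poch_bounded p dp; have [C2 C20 H2] := rp_bounded dp.
exists (C1 * C2 * (C1 * C2)) => [|M x l]; first by rewrite !mulr_ge0.
by rewrite /weight !normrM !rmorphM /= !ler_pM ?mulr_ge0.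
Qed.

Lemma weight_lim x l : seq_cvg (fun M => weight q M x l) 1.
Proof.
have p0 := qpoch_inf_neq0_disc dp dp; rewrite /weight -/p.
rewrite -[X in seq_cvg _ X](_ : qpoch_inf p p * (qpoch_inf p p)^-1 * (qpoch_inf p p * (qpoch_inf p p)^-1) = 1); last by field.
apply: seq_cvgM; apply: seq_cvgM.
- apply: (@seq_cvg_comp _ (poch p p) _ (fun M => M - last 0%N l)%N); last exact: poch_lim.
  by move=> N; exists (N + last 0%N l)%N => M; lia.
- apply: (@seq_cvg_eq _ (fun M => rp p (M%:Z + (- (last 0%N l)%:Z - x%:Z)))); last exact: rp_lim.
  by move=> M; rewrite addrA.
- exact: poch_lim.
- exact: rp_lim.
Qed.

Let term (n : {ffun 'I_s.+2 -> nat}) := nahm_term (B_vee s.+2) (2 *: b_vec s.+2 i) (2 * c_const s.+2 i)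
  (fun k : 'I_s.+2 => (2 * d_vee k)%N) tau n.
Let Qc := qpow (2 * c_const s.+2 i) tau.
Let part (sigma : nat) (n : {ffun 'I_s.+2 -> nat}) : R[i] :=
  if [forall k : 'I_s.+2, (k.+1 == s.+2) ==> (n k == sigma %[mod 2])] then term n else 0.

Lemma partE sigma (n : {ffun 'I_s.+2 -> nat}) : part sigma n = if (n ord_max == sigma %[mod 2])%N then term n else 0.
Proof.
congr (if _ then _ else _); apply/forallP/idP => [/(_ ord_max)|H k]; first by rewrite eqxx.
apply/implyP => /eqP ks; rewrite (_ : k = ord_max) //.
by apply: val_inj; rewrite /=; lia.
Qed.

Lemma part_diff (n : {ffun 'I_s.+2 -> nat}) : part 0 n - part 1 n = Qc * g n.
Proof.
rewrite -nahm_term_body // -/(term n) !partE !modn2 /= -signr_odd.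
by case: odd; rewrite /= ?expr1 ?expr0 ?subr0 ?sub0r ?mul1r ?mulN1r.
Qed.

Lemma part_bound sigma (n : {ffun 'I_s.+2 -> nat}) : `|part sigma n| <= `|Qc * g n|.
Proof.
rewrite -nahm_term_body // -/(term n) normrM normrX normrN1 expr1n mul1r partE.
by case: ifP => // _; rewrite normr0.
Qed.

Lemma F_sum_diff (L : R[i]) :
  seq_cvg (fun M => poch (- q) p (M + (i == 0%N)) * poch p p M
     * chain_sum p lam (beta q (i == 0%N)) M.+1 s.+1 M) L ->
  F_sum s.+2 i 0 tau - F_sum s.+2 i 1 tau = Qc * L.
Proof.
move=> HL; have [C C0 [x [x0 x1 Hg]]] := body_bound; have [W W0 HW] := weight_bound.
have [c cE] := normE Qc; have c0 : 0 <= c := in_disc_ge0 cE.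
have Gb D : 0 <= D -> bounded_sums (fun n : {ffun 'I_s.+2 -> nat} => D * \prod_k x ^+ n k).
  exact: geometric_ffun_bounded.
have partG sigma n : `|part sigma n| <= (c * C * \prod_k x ^+ n k)%:C.
  apply: le_trans (part_bound _ _) _; rewrite normrM cE -mulrA [leRHS]rmorphM /=.
  by rewrite ler_wpM2l ?ler0c.
pose w M (n : {ffun 'I_s.+2 -> nat}) := weight q M (n ord0) (tail n).
have lim sigma : seq_cvg (fun M => \sum_(n <- box s.+2 M) w M n * part sigma n) (F_sum s.+2 i sigma tau).
  have [S HS] := dominated_has_sum (Gb _ (mulr_ge0 c0 C0)) (partG sigma).
  have -> : F_sum s.+2 i sigma tau = S by exact: (has_sum_sum HS).
  have H1 : seq_cvg (fun M => \sum_(n <- box s.+2 M) part sigma n) S.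
    split; apply: (has_sum_seq HS); first exact: box_uniq.
    exact: mem_box.
  (* The weights are bounded and tend to 1, so inserting them leaves the limit unchanged. *)
  have H2 : seq_cvg (fun M => \sum_(n <- box s.+2 M) (w M n - 1) * part sigma n) 0.
    have D0 : 0 <= (W + 1) * (c * C) by rewrite !mulr_ge0 ?addr_ge0.
    split; apply: (tannery (Gb _ D0)); first exact: box_uniq.
      move=> M n; rewrite normrM -mulrA [leRHS]rmorphM /=; apply: ler_pM => //.
      rewrite rmorphD rmorph1; apply: le_trans (ler_normB _ _) _; rewrite normr1 lerD2r.
      exact: HW.
    move=> n; apply: seq_cvgP.
    rewrite -[X in seq_cvg _ X](_ : (1 - 1) * part sigma n = 0); last by rewrite subrr mul0r.
    apply: seq_cvgM (seq_cvg_cst _); apply: seq_cvgB (seq_cvg_cst _).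
    exact: weight_lim.
  rewrite -[X in seq_cvg _ X]addr0; apply: seq_cvg_eq (seq_cvgD H1 H2) => M.
  by rewrite -big_split /=; apply: eq_bigr => n _; ring.
apply: (seq_cvg_unique (seq_cvgB (lim 0%N) (lim 1%N))).
apply: seq_cvg_eq (seq_cvgM (seq_cvg_cst Qc) HL) => M.
have q_neq1 n := in_disc_neq1 n dq.
rewrite -(weighted_sum q_neq1 q0) // -big_box -sumrB mulr_sumr.
apply: eq_bigr => n _; rewrite -mulrBr part_diff mulrCA; congr (_ * _).
  by rewrite enum_ordSl /= -map_comp.
by rewrite enum_ordSl /= -map_comp.
Qed.

End NahmSum.

(** * The product formula and its comparison with h_j^vee *)

Lemma distribute_unit (K : comPzRingType) (h c A B x y : K) :
  x * y = 1 -> h * c * (A + B) = h * (c * A + x * (c * y * B)).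
Proof. by move=> xy; rewrite -[LHS]mul1r mulrDr mulrDr -{2}xy; ring. Qed.

Section Assembly.
Variables (R : realType) (s i : nat).
Hypothesis is1 : (i <= s.+1)%N.

(* [z_exp] is the exponent 2r+j-2, where r = s+2 and j is the index attached to
   i; the three exponents of the product are then 4r-3-[z_exp], [z_exp], 4r-3. *)
Definition z_exp : nat := (if i == 0 then 4 * s + 4 else 4 * s + 5 - 2 * i)%N.

Lemma chain_sum_theta (q : R[i]) M : (forall n, q ^+ n.+1 != 1) -> q != 0 ->
  chain_sum (q ^+ 2) (lam_of s i) (beta q (i == 0%N)) M.+1 s.+1 M =
  bsum M.+2 (fun k => theta_term (q ^+ z_exp) (q ^+ (4 * s + 5)) k
    * kern (q ^+ 2) (i == 0%N) M%:Z k).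
Proof.
move=> q_neq1 q0; have K2 : 2%:R != 0 :> R[i] by rewrite pnatr_eq0.
rewrite /lam_of /z_exp; case: (i =P 0%N) => [_|i0].
  rewrite chain_sum_odd //; apply: eq_bsum => k; rewrite coef_theta //; congr (_ * _).
  apply: eq_coef; have k2 : k ^+ 2 = tri k * 2 + k by rewrite triE; ring.
  have -> : (4 * s + 4)%N%:Z = 2 * s.+1%:Z * 2 by lia.
  have -> : (4 * s + 5)%N%:Z = 2 * s.+1%:Z * 2 + 1 by lia.
  by rewrite k2; ring.
(* Of the r-1 steps, r-i eliminate N_r, ..., N_(i+1), and the other i-1 eliminate N_i, ..., N_2. *)
rewrite [LHS](_ : _ = chain_sum (q ^+ 2) (lam_mid (s.+2 - i)) (beta q 0) M.+1
  ((i - 1) + (s.+2 - i)) M); last by congr chain_sum; lia.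
rewrite (chain_sum_even q_neq1 q0 K2) //; last by lia.
apply: eq_bsum => k; rewrite coef_theta //; congr (_ * _).
apply: eq_coef; have k2 : k ^+ 2 = tri k * 2 + k by rewrite triE; ring.
have -> : (i - 1)%N%:Z = i%:Z - 1 by lia.
have -> : (s.+2 - i)%N%:Z = s%:Z + 2 - i%:Z by lia.
have -> : (4 * s + 5 - 2 * i)%N%:Z = 4 * s%:Z + 5 - 2 * i%:Z by lia.
have -> : (4 * s + 5)%N%:Z = (2 * s%:Z + 2) * 2 + 1 by lia.
by rewrite k2; ring.
Qed.

Lemma F_sum_product (tau : R[i]) : 0 < complex.Im tau -> let q := qpow 1 tau in
  F_sum s.+2 i 0 tau - F_sum s.+2 i 1 tau = qpow (2 * c_const s.+2 i) tau *
  (qpochs_inf [:: q ^+ (4 * s + 5 - z_exp); q ^+ z_exp; q ^+ (4 * s + 5)] (q ^+ (4 * s + 5))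
   / qpochs_inf [:: q; q ^+ 3; q ^+ 4] (q ^+ 4)).
Proof.
move=> htau q; have dq : in_disc q := norm_qpow1_lt1 htau.
have q0 : q != 0 := qpow_neq0 _ _.
have dp : in_disc (q ^+ 2) := in_disc_exp 1 dq.
have q_neq1 n := in_disc_neq1 n dq.
have p0 : q ^+ 2 != 0 by rewrite expf_neq0.
have zQ : (0 < z_exp < 4 * s + 5)%N by rewrite /z_exp; case: eqP => i0; lia.
apply: F_sum_diff => //; rewrite -/q.
rewrite -infinite_product_identity // qpochs_inf3.
have L := theta_limit (i == 0%N) dq q0 dp p0 zQ.
(* Completing (p; p)_M to the square needed by [theta_limit] costs a factor 1/(p; p)_M, so the
   prefactor tends to (-q; p)_oo / (p; p)_oo. *)
apply: (@seq_cvg_eq _ (fun M => poch (- q) (q ^+ 2) (M + (i == 0%N)) * (poch (q ^+ 2) (q ^+ 2) M)^-1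
   * (poch (q ^+ 2) (q ^+ 2) M ^+ 2 * bsum M.+2 (fun k => theta_term (q ^+ z_exp) (q ^+ (4 * s + 5)) k
    * kern (q ^+ 2) (i == 0%N) M%:Z k)))).
  move=> M; rewrite chain_sum_theta //.
  have P0 := poch_neq0 (fun n => in_disc_neq1 n dp) M.
  by field.
rewrite mulrC [X in _ * X](_ : _ = qpoch_inf (q ^+ z_exp) (q ^+ (4 * s + 5)) *
  qpoch_inf (q ^+ (4 * s + 5 - z_exp)) (q ^+ (4 * s + 5)) *
  qpoch_inf (q ^+ (4 * s + 5)) (q ^+ (4 * s + 5))); last by rewrite [X in X * _]mulrC.
apply: seq_cvgM L; apply: seq_cvgM.
  apply: (@seq_cvg_comp _ _ _ (fun M => M + (i == 0%N))%N); last exact: poch_lim.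
  by move=> N; exists N => M; lia.
by apply: seq_cvgV; [exact: qpoch_inf_neq0_disc | exact: poch_lim].
Qed.

Lemma h_vee_F_sum (tau : R[i]) j : 0 < complex.Im tau -> (2 * s.+2 + j - 2 = z_exp)%N ->
  (j%:R ^+ 2 - j%:R - s.+2%:R + 1) / (8 * s.+2%:R - 6) = 2 * c_const s.+2 i ->
  h_vee s.+2 j (2 * tau) =
    2^-1 * (F_sum s.+2 i 0 tau - F_sum s.+2 i 1 tau
            + e2pi (- ratr (c_const s.+2 i))
              * (F_sum s.+2 i 0 (tau + 2^-1) - F_sum s.+2 i 1 (tau + 2^-1))).
Proof.
move=> htau jz cE; have zQ : (z_exp <= 4 * s + 5)%N by rewrite /z_exp; case: eqP => i0; lia.
have htau' : 0 < complex.Im (tau + 2^-1).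
  have -> : (2^-1 : R[i]) = (2^-1)%:C by rewrite fmorphV /= rmorph_nat.
  by case: (tau) htau => a b /=; rewrite addr0.
have E1 := F_sum_product htau; have E2 := F_sum_product htau'.
rewrite /= qpow1_half qpow_half in E2.
have c2 : ratr (2 * c_const s.+2 i) / 2 = ratr (c_const s.+2 i) :> R[i].
  by rewrite rmorphM /= ratr_nat mulrAC mulfV ?mul1r // pnatr_eq0.
rewrite c2 in E2.
apply: etrans (congr2 (fun X Y => 2^-1 * (X + e2pi (- ratr (c_const s.+2 i)) * Y))
  (esym E1) (esym E2)).
rewrite /h_vee cE (_ : 2 * tau / 2 = tau); last by rewrite mulrAC mulfV ?mul1r // pnatr_eq0.
set q := qpow 1 tau.
rewrite (_ : 2 * s.+2 - j - 1 = 4 * s + 5 - z_exp)%N; last lia.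
rewrite jz (_ : 4 * s.+2 - 3 = 4 * s + 5)%N; last lia.
have eN : (- q) ^+ (4 * s + 5) = - q ^+ (4 * s + 5).
  by rewrite exprNn -signr_odd oddD oddM /= expr1 mulN1r.
have e3 : (- q) ^+ 3 = - q ^+ 3 by rewrite exprNn -signr_odd expr1 mulN1r.
have e4 : (- q) ^+ 4 = q ^+ 4 by rewrite exprNn -signr_odd expr0 mul1r.
rewrite eN e3 e4.
by apply: distribute_unit; rewrite -e2piD addNr e2pi0.
Qed.

End Assembly.

(* In h_j^vee the factor q^((j^2-j-r+1)/(8r-6)) = q^(2 c_i) is kept fixed when q
   is replaced by -q. Accordingly the root of unity e^(2 pi sqrt(-1) c_i) which
   tau -> tau + 1/2 produces on q^(2 c_i) is cancelled; without this the
   identities fail at leading order, e.g. for r = 2, where c_0 = 1/20. *)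
Theorem proposition1p11 (R : realType) (r : nat) (hr : (2 <= r)%N)
    (tau : R[i]) (htau : 0 < complex.Im tau) :
  h_vee r (2 * r - 2) (2 * tau) =
    2^-1 * (F_sum r 0 0 tau - F_sum r 0 1 tau
            + e2pi (- ratr (c_const r 0))
              * (F_sum r 0 0 (tau + 2^-1) - F_sum r 0 1 (tau + 2^-1)))
  /\
  forall j : nat, odd j -> (1 <= j <= 2 * r - 3)%N ->
    let i := (r - (j + 1) %/ 2)%N in
    h_vee r j (2 * tau) =
      2^-1 * (F_sum r i 0 tau - F_sum r i 1 tau
              + e2pi (- ratr (c_const r i))
                * (F_sum r i 0 (tau + 2^-1) - F_sum r i 1 (tau + 2^-1))).
Proof.
case: r hr => [|[|s]] // _.
have s0 : 0 <= s%:R :> rat by exact: ler0n.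
split.
  apply: h_vee_F_sum => //; first by rewrite /z_exp eqxx; lia.
  rewrite /c_const /= (_ : (2 * s.+2 - 2 = 2 * s + 2)%N); last lia.
  rewrite natrD natrM -!natr1; field.
  by apply/andP; split; apply: lt0r_neq0; lra.
move=> j oj /andP[j1 j2] i.
(* With j = 2k+1 one has i = r-k-1, hence 2r+j-2 = 4r-3-2i, the value of [z_exp]. *)
have [k jk] : exists k, j = k.*2.+1 by exists j./2; rewrite -[LHS]odd_double_half oj.
have ik : i = (s.+2 - k.+1)%N by rewrite /i jk; congr (_ - _)%N; lia.
have ks : (k <= s)%N by lia.
have i0 : (i == 0%N) = false by rewrite ik; lia.
apply: h_vee_F_sum => //; first by rewrite ik; lia.
  by rewrite /z_exp i0 ik jk; lia.
rewrite /c_const i0 ik jk natrB; last by lia.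
rewrite -!natr1 -mul2n natrM; field.
by apply/andP; split; apply: lt0r_neq0; lra.
Qed.
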